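(* Suppose $X,X_1,\ldots,X_m$, $Y,Y_1,\ldots,Y_n$ are independent random variables with zero mean, unit variance and bounded absolute third moment, with $X_i\stackrel{\mathcal{D}}{=}X$ for all $i=1,\ldots,m$ and $Y_j\stackrel{\mathcal{D}}{=}Y$ for all $j=1,\ldots,n$. Let $W_1=\sum_{i=1}^mX_i$, $W_2=\sum_{j=1}^nY_j$ and set $W=\frac{1}{\sqrt{mn}}W_1W_2$. Then, for $h\in C_b^1(\mathbb{R})$, we have $$|\mathbb{E}h(W)-\mathrm{PN}_2^1h|\leq\frac{13}{8}\bigg(\frac{1}{\sqrt m}+\frac{1}{\sqrt n}\bigg)\bigg[\|h'\|+\frac92\|h-\mathrm{PN}_2^1h\|\bigg]\mathbb{E}|X|^3|Y|^3.$$
   Context: $\mathrm{PN}_2^1h=\mathbb{E}h(Z_1Z_2)$ with $Z_1,Z_2$ independent $N(0,1)$ random variables. $C_b^1(\mathbb{R})$ is the space of bounded differentiable functions on $\mathbb{R}$ with bounded first derivative. $\|g\|=\sup_{x\in\mathbb{R}}|g(x)|$. $\stackrel{\mathcal{D}}{=}$ is equality in distribution; ''bounded absolute third moment'' means $\mathbb{E}|X|^3,\mathbb{E}|Y|^3<\infty$. *)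

(* Defs.v *)
From HB Require Import structures.
From mathcomp Require Import all_boot all_order all_algebra.
From mathcomp Require Import all_classical all_reals all_analysis.
From mathcomp Require Import measurable_realfun.
Set Implicit Arguments.
Unset Strict Implicit.
Unset Printing Implicit Defensive.
Import Order.TTheory GRing.Theory Num.Theory.
Import numFieldNormedType.Exports.
Local Open Scope classical_set_scope.
Local Open Scope ring_scope.

(* For unbounded g this is the junk value sup = 0; below it is only applied to
   bounded functions. *)
Definition supnorm (R : realType) (g : R -> R) : R :=
  sup (range (fun x => `|g x|)).

(* The derivative is required to be bounded but not to be continuous. *)
Definition C1b (R : realType) (h : R -> R) : Prop :=
  [/\ forall x, derivable h x 1, bounded_fun h & bounded_fun h^`()%classic].

(* The product rule over all subfamilies; [I] being finite, every subfamily is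
   finite. *)
Definition mutually_independent (d : measure_display) (T : measurableType d)
    (R : realType) (P : probability T R) (I : finType)
    (X : I -> {RV P >-> R}) : Prop :=
  forall (J : {set I}) (A : I -> set R), (forall i, measurable (A i)) ->
    P (\bigcap_(i in [set` J]) X i @^-1` A i) =
    (\prod_(i in J) P (X i @^-1` A i))%E.

(* Laws are compared on measurable sets only: the value of a measure on a
   non-measurable set carries no information. *)
Definition eq_distr (d : measure_display) (T : measurableType d)
    (R : realType) (P : probability T R) (X Y : {RV P >-> R}) : Prop :=
  forall A : set R, measurable A -> distribution P X A = distribution P Y A.

Definition standard_normal (d : measure_display) (T : measurableType d)
    (R : realType) (P : probability T R) (Z : {RV P >-> R}) : Prop :=
  forall A : set R, measurable A -> distribution P Z A = normal_prob 0 1 A.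

Definition two_samples (d : measure_display) (T : measurableType d)
    (R : realType) (P : probability T R) (m n : nat)
    (X : {RV P >-> R}) (Xs : 'I_m -> {RV P >-> R})
    (Y : {RV P >-> R}) (Ys : 'I_n -> {RV P >-> R})
    (k : option 'I_m + option 'I_n) : {RV P >-> R} :=
  match k with
  | inl None => X
  | inl (Some i) => Xs i
  | inr None => Y
  | inr (Some j) => Ys j
  end.

(* E h(Z1 Z2), where Z1 and Z2 are the coordinates on R * R under the product
   of two N(0,1) laws; [PN21E] shows that any other independent pair of N(0,1)
   random variables gives the same value. *)
Definition PN21 (R : realType) (h : R -> R) : R :=
  fine 'E_(normal_prob (0 : R) 1 \x normal_prob (0 : R) 1)%E
    [fun z : R * R => h (z.1 * z.2)].

Lemma PN21E (R : realType) (d : measure_display) (T : measurableType d)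
    (P : probability T R) (Z1 Z2 : {RV P >-> R}) (h : R -> R) :
  mutually_independent (fun b : bool => if b then Z1 else Z2) ->
  standard_normal Z1 -> standard_normal Z2 ->
  measurable_fun setT h -> bounded_fun h ->
  fine 'E_P[fun w => h (Z1 w * Z2 w)] = PN21 h.
Proof.
move=> ind n1 n2 mh bh; congr fine; rewrite unlock.
pose RR := measurableTypeR R.
pose Z w : RR * RR := (Z1 w, Z2 w).
have mZi (Zi : {RV P >-> R}) : measurable_fun setT (Zi : T -> RR).
  exact: (@measurable_funPT _ _ T R Zi).
have mZ : measurable_fun setT Z by exact: measurable_fun_pair.
pose Zm : {mfun T >-> (RR * RR)%type} := HB.pack Z (isMeasurableFun.Build _ _ _ _ Z mZ).
have lawE A : measurable A ->
    (normal_prob (0 : R) 1 \x normal_prob (0 : R) 1)%E A = distribution P Zm A.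
  move=> mA; apply: (@product_measure_unique _ _ _ _ R (normal_prob 0 1)
    (normal_prob 0 1) (distribution P Zm)) => // {mA}A B mA mB.
  have := ind [set: bool]%SET (fun b => if b then A else B).
  rewrite big_mkcond big_bool !inE /= -n1// -n2// => <-; last by case.
  rewrite /distribution /pushforward; congr (P _); apply/seteqP; split => w /=.
    by case=> Aw Bw [].
  by move=> H; split; [have := H true | have := H false]; apply; rewrite /= inE.
have mmul : measurable_fun setT (fun z : RR * RR => (z.1 : R) * (z.2 : R)).
  apply: measurable_funM.
    exact: (@measurable_fst _ _ RR RR).
  exact: (@measurable_snd _ _ RR RR).
have mf : measurable_fun setT (fun z : RR * RR => (h (z.1 * z.2))%:E).
  by apply/measurable_EFinP; exact: (measurableT_comp mh mmul).
rewrite [RHS](eq_measure_integral (distribution P Zm)); last first.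
  by move=> A mA _; exact: lawE.
rewrite integral_distribution//.
have [M [_ hM]] := bh.
apply: (@le_integrable _ _ _ P _ measurableT _ (cst (M + 1)%:E)).
- exact: measurableT_comp mf mZ.
- move=> w _ /=; rewrite lee_fin.
  by apply: (le_trans (hM (M + 1) _ _ _)); rewrite ?ltrDl// ler_norm.
- exact: finite_measure_integrable_cst.
Qed.

(* Main.v *)
Require Import Defs.
From HB Require Import structures.
From mathcomp Require Import all_boot all_order all_algebra.
From mathcomp Require Import all_classical all_reals all_analysis.
From mathcomp Require Import measurable_realfun.
From mathcomp Require Import ring lra.
Set Implicit Arguments.
Unset Strict Implicit.
Unset Printing Implicit Defensive.
Import Order.TTheory GRing.Theory Num.Theory.
Import numFieldNormedType.Exports.
Local Open Scope classical_set_scope.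
Local Open Scope ring_scope.

(** Write [U = W1 / sqrt m], [V = W2 / sqrt n], [K] for the supremum of [|h'|],
and [H y] for the mean of [h (Z y)] with [Z] standard normal. The two factors of
[h (U V)] are replaced by Gaussian ones in turn. Given [V = v], the variable [U]
only enters through [x |-> h (x v)], which is [K |v|]-Lipschitz; since
[E|V| <= 1], a bound [C K E|X|^3 / sqrt m] for the Wasserstein-type central limit
theorem on [K]-Lipschitz functions gives
[|E h (U V) - E H (V)| <= C K E|X|^3 / sqrt m]. Next, [H] is again [K]-Lipschitz
because [E|Z| <= 1], and its Gaussian mean is the product normal mean of [h], so
that [|E H (V) - E H (Z)| <= C K E|Y|^3 / sqrt n]. Both third moments are at
least 1 and their product is [E|X|^3|Y|^3] by independence, so the two errors add
up to at most [C (1 / sqrt m + 1 / sqrt n) K E|X|^3|Y|^3].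

All that matters is therefore the one-dimensional theorem [wasserstein_clt] with
the constant [C = 13/8]. It is proved by Stein's method, and the constant is the
product of two others.

The factor 2 is in [stein_solution]: the solution [f] of
[f' x - x f x = h x - E h(Z)] has a [2 K]-Lipschitz derivative. Indeed
[x |-> x f x] is [K]-Lipschitz: it depends linearly on [h], equals [- x] for
[h x = x], and is nonincreasing as soon as [h] is nondecreasing ([stein_ndecr], a
consequence of Mills' bounds on Gaussian tails), so it suffices to look at
[K x + h x] and [K x - h x].

The factor 13/16 is in [stein_identity_defect]: a standardized variable [X]
satisfies [|E X G(X) - E g(X)| <= 13/16 M E|X|^3] when [g] is the derivative of
[G] and is [M]-Lipschitz. Symmetrizing with an independent copy of [X] turns the
left-hand side into the error of the trapezoidal rule for [g] plus a product of
differences; this leads to the cubic inequality [cubic_bound], in which multiples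
of [x y |x|] and [x y |y|] may be added freely because they have mean zero. *)

(** * Calculus and real-valued integrals *)

Lemma normr_sqr1 (R : realType) (s : R) : s ^+ 2 = 1 -> `|s| = 1.
Proof. by move=> /eqP; rewrite sqrf_eq1 => /orP[]/eqP ->; rewrite ?normrN normr1. Qed.

Lemma is_derive1_continuous (R : realType) (f df : R -> R) :
  (forall x, is_derive x (1 : R) f (df x)) -> continuous f.
Proof.
move=> fd x; apply: differentiable_continuous.
by apply/derivable1_diffP; exact: ex_derive.
Qed.

Lemma derive_ge0_le (R : realType) (f df : R -> R) (a b : R) : a <= b ->
  (forall x, is_derive x (1 : R) f (df x)) ->
  (forall x, a < x < b -> 0 <= df x) -> f a <= f b.
Proof.
rewrite le_eqVlt => /predU1P[->//|ab] fd df0.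
have cf : {within `[a, b], continuous f}.
  by apply: continuous_subspaceT; exact: is_derive1_continuous fd.
have [c + fE] := MVT ab (fun t _ => fd t) cf.
rewrite in_itv/= => cab.
by rewrite -subr_ge0 fE mulr_ge0 ?df0// subr_ge0 ltW.
Qed.

Lemma derive_bounded_lipschitz (R : realType) (f df : R -> R) K :
  (forall x, is_derive x (1 : R) f (df x)) -> (forall x, `|df x| <= K) ->
  forall x y, `|f x - f y| <= K * `|x - y|.
Proof.
move=> fd dfK x y; wlog xy : x y / y < x => [H|].
  case: (ltgtP x y) => [xy|yx|->]; last by rewrite !subrr normr0 mulr0.
    by rewrite distrC (distrC x) H.
  by rewrite H.
have cf : {within `[y, x], continuous f}.
  by apply: continuous_subspaceT; exact: is_derive1_continuous fd.
have [c _ ->] := MVT xy (fun t _ => fd t) cf.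
by rewrite normrM ler_wpM2r.
Qed.

Lemma lipschitz_continuous (R : realType) (h : R -> R) K :
  (forall x y, `|h x - h y| <= K * `|x - y|) -> continuous h.
Proof.
move=> hK x; apply/cvgrPdist_le => e e0.
near=> y.
apply: (le_trans (hK _ _)).
have K1 : 0 < `|K| + 1 by rewrite ltr_wpDl.
apply: (@le_trans _ _ ((`|K| + 1) * `|x - y|)).
  by rewrite ler_wpM2r// (le_trans (ler_norm _))// lerDl.
rewrite -ler_pdivlMl// mulrC.
near: y; apply: cvgr_dist_le; first exact: cvg_id.
by rewrite divr_gt0.
Unshelve. all: by end_near. Qed.

Lemma lipschitz_affine_bound (R : realType) (h : R -> R) K :
  (forall x y, `|h x - h y| <= K * `|x - y|) ->
  forall x, `|h x| <= `|h 0| + K * `|x|.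
Proof.
move=> hK x; have := hK x 0; rewrite subr0.
have := ler_normD (h x - h 0) (h 0); rewrite subrK; lra.
Qed.

Lemma lipschitz_measurable (R : realType) (h : R -> R) K :
  (forall x y, `|h x - h y| <= K * `|x - y|) -> measurable_fun setT h.
Proof. by move/lipschitz_continuous; exact: continuous_measurable_fun. Qed.

Section real_integrals.
Context d (T : measurableType d) (R : realType).
Variable mu : {measure set T -> \bar R}.
Variables (D : set T) (mD : measurable D).
Implicit Types f g : T -> R.

Local Notation itg f := (mu.-integrable D (EFin \o f)).

Lemma itgD f g : itg f -> itg g -> itg (fun x => f x + g x).
Proof. exact: integrableD. Qed.

Lemma itgB f g : itg f -> itg g -> itg (fun x => f x - g x).
Proof. exact: integrableB. Qed.

Lemma itgZ r f : itg f -> itg (fun x => r * f x).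
Proof. exact: integrableZl. Qed.

Lemma itg_dom f g : measurable_fun D f -> itg g ->
  (forall x, D x -> `|f x| <= g x) -> itg f.
Proof.
move=> mf ig fg; apply: (le_integrable mD _ _ ig).
  exact/measurable_EFinP.
move=> x Dx; rewrite lee_fin (le_trans (fg _ Dx))//.
exact: ler_norm.
Qed.

Lemma itg_norm f : itg f -> itg (fun x => `|f x|).
Proof. exact: integrable_abse. Qed.

Lemma itg_measurable f : itg f -> measurable_fun D f.
Proof. by move/integrableP => -[/measurable_EFinP]. Qed.

Lemma RintegralN f : itg f ->
  Rintegral mu D (fun x => - f x) = - Rintegral mu D f.
Proof.
move=> ifx; rewrite -mulN1r -RintegralZl//.
by apply: eq_Rintegral => x _; rewrite mulN1r.
Qed.

End real_integrals.

(** * The Gaussian density *)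

Section gaussian_density.
Variable R : realType.
Local Notation mu := (@lebesgue_measure R).
Local Notation phi := (normal_pdf (0 : R) 1).

Lemma phiE x : phi x = normal_peak 1 * expR (- (x ^+ 2 / 2)).
Proof.
by rewrite normal_pdfE ?oner_eq0// /normal_fun subr0 expr1n mulNr.
Qed.

Lemma phi_gt0 x : 0 < phi x.
Proof. by rewrite phiE mulr_gt0 ?expR_gt0 ?normal_peak_gt0 ?oner_eq0. Qed.

Lemma phi_le_peak x : phi x <= normal_peak 1.
Proof. exact: normal_pdf_ub (oner_neq0 _). Qed.

Lemma phiN x : phi (- x) = phi x.
Proof. by rewrite !phiE sqrrN. Qed.

Lemma is_derive_phi (x : R) : is_derive x 1 (phi : R -> R) (- (x * phi x)).
Proof.
have -> : phi = (fun x => normal_peak 1 * expR (- (x ^+ 2 / 2))).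
  by apply/funext => t; exact: phiE.
have h : is_derive x 1 (fun t : R => - (t ^+ 2 / 2)) (- x).
  apply: is_derive_eq.
  rewrite /GRing.scale/= !mulr1 !mulr0 add0r; lra.
have := is_derive1_comp (is_derive_expR _) h.
move=> /(@is_deriveZ _ _ _ _ (normal_peak 1)) H.
apply: (is_derive_eq H).
by rewrite /GRing.scale/=; ring.
Qed.

Lemma continuous_phi : continuous (phi : R -> R).
Proof. exact: continuous_normal_pdf (oner_neq0 _). Qed.

Lemma measurable_phi : measurable_fun setT (phi : R -> R).
Proof. exact: measurable_normal_pdf. Qed.

Lemma itg_phi : mu.-integrable setT (EFin \o phi).
Proof. exact: integrable_normal_pdf. Qed.

Lemma Rintegral_phi : \int[mu]_x phi x = 1.
Proof. by rewrite /Rintegral integral_normal_pdf. Qed.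

Lemma cvg_phi : phi x @[x --> +oo] --> (0 : R).
Proof.
have cvgE : normal_peak 1 * expR (- x) @[x --> +oo] --> (0 : R).
  rewrite -(mulr0 (normal_peak 1)); apply: cvgM; first exact: cvg_cst.
  exact: cvgr_expR.
apply: (squeeze_cvgr _ (cvg_cst 0) cvgE).
near=> x; rewrite ltW ?phi_gt0//= phiE ler_wpM2l ?normal_peak_ge0//.
have x2 : 2 <= x by near: x; exact: nbhs_pinfty_ge.
rewrite ler_expR lerN2; nra.
Unshelve. all: by end_near. Qed.

(** An antiderivative of [t * phi t] is [- phi t]. *)
Lemma integral_tphi0y :
  (\int[mu]_(t in `[0%R, +oo[) (t * phi t)%:E = (phi 0)%:E)%E.
Proof.
rewrite (@ge0_continuous_FTC2y _ _ (fun t => - phi t) 0 0).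
- by rewrite -EFinB sub0r opprK.
- by move=> t t0; rewrite mulr_ge0// ltW// phi_gt0.
- apply: continuous_subspaceT => t; apply: cvgM; first exact: cvg_id.
  exact: continuous_phi.
- by have := cvgN cvg_phi; rewrite oppr0; exact.
- by move=> t _; apply: derivableN; apply: ex_derive; exact: is_derive_phi.
- apply: cvg_at_right_filter; apply: cvgN; exact: continuous_phi.
- move=> t _; rewrite derive1E deriveN ?opprK; last first.
    by apply: ex_derive; exact: is_derive_phi.
  by rewrite (@derive_val _ _ _ _ _ _ _ (is_derive_phi t)) opprK.
Qed.

Lemma integral_normtphi :
  (\int[mu]_t (`|t| * phi t)%:E = (2 * phi 0)%:E)%E.
Proof.
rewrite (@ge0_symfun_integralT _ (fun t => `|t| * phi t)).
- rewrite [X in (_ * X)%E](_ : _ = (phi 0)%:E) ?EFinM//.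
  rewrite -integral_tphi0y; have <- : [set x | 0 <= x] = `[0, +oo[%classic :> set R.
    by apply/seteqP; split => x /=; rewrite in_itv/= andbT.
  by apply: eq_integral => x; rewrite inE/= => x0; rewrite ger0_norm.
- by move=> t; rewrite mulr_ge0// ltW// phi_gt0.
- move=> t; apply: cvgM; first exact: norm_continuous.
  exact: continuous_phi.
- by move=> t /=; rewrite normrN phiN.
Qed.

Lemma itg_normtphi : mu.-integrable setT (EFin \o (fun t => `|t| * phi t)).
Proof.
apply/integrableP; split.
  apply/measurable_EFinP/measurable_funM; last exact: measurable_phi.
  exact: normr_measurable.
under eq_integral.
  move=> t _; rewrite gee0_abs/=; first over.
  by rewrite lee_fin mulr_ge0// ltW// phi_gt0.
by rewrite /= integral_normtphi ltry.
Qed.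

Lemma itg_tphi : mu.-integrable setT (EFin \o (fun t => t * phi t)).
Proof.
apply: (itg_dom measurableT _ itg_normtphi).
  by apply: measurable_funM => //; exact: measurable_phi.
by move=> t _; rewrite normrM (gtr0_norm (phi_gt0 _)).
Qed.

(** The integral is [2 * phi 0], that is, the square root of [2 / pi]. *)
Lemma Rintegral_normtphi_le1 : \int[mu]_t (`|t| * phi t) <= 1.
Proof.
rewrite /Rintegral integral_normtphi/= phiE expr0n/= mul0r oppr0 expR0 mulr1.
rewrite /normal_peak expr1n mul1r ler_pdivrMr ?mul1r; last first.
  by rewrite sqrtr_gt0 mulrn_wgt0// pi_gt0.
rewrite -(@ler_pXn2r _ 2)// ?nnegrE ?sqrtr_ge0// sqr_sqrtr; last first.
  by rewrite mulrn_wge0// pi_ge0.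
have := pi_ge2 R; lra.
Qed.

Lemma Rintegral_itvNyo f x : mu.-integrable setT (EFin \o f) ->
  \int[mu]_t f t - \int[mu]_(t in `]-oo, x]) f t = \int[mu]_(t in `]x, +oo[) f t.
Proof.
move=> fi.
rewrite -(@Rintegral_itvB _ f -oo%O +oo%O x)//; first by rewrite set_itvNyy.
by rewrite set_itvNyy.
Qed.

Lemma Rintegral_tphi_Ny0 : \int[mu]_(t in `]-oo, 0]) (t * phi t) = - phi 0.
Proof.
have := @Rintegral_itvNyo (fun t => `|t| * phi t) 0 itg_normtphi.
rewrite Rintegral_itv_obnd_cbnd; last first.
  by apply: integrableS itg_normtphi.
have -> : \int[mu]_(t in `[0, +oo[) (`|t| * phi t) = phi 0.
  transitivity (\int[mu]_(t in `[0, +oo[) (t * phi t)).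
    apply: eq_Rintegral => t; rewrite inE/= in_itv/= andbT => t0.
    by rewrite ger0_norm.
  by rewrite /Rintegral integral_tphi0y.
rewrite /Rintegral integral_normtphi/= -!/(Rintegral _ _ _).
have -> : \int[mu]_(t in `]-oo, 0]) (`|t| * phi t) =
          - \int[mu]_(t in `]-oo, 0]) (t * phi t).
  rewrite -RintegralN//; last by apply: integrableS itg_tphi.
  apply: eq_Rintegral => t; rewrite inE/= in_itv/= => t0.
  by rewrite ler0_norm// mulNr.
lra.
Qed.

Lemma is_derive_Rintegral (f : R -> R) (x : R) :
  mu.-integrable setT (EFin \o f) -> continuous f ->
  is_derive x 1 (fun y : R => \int[mu]_(t in `]-oo, y]) f t) (f x).
Proof.
move=> fi cf.
have fi' : mu.-integrable [set` Interval -oo%O (BRight (x + 1))] (EFin \o f).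
  by apply: integrableS fi.
have xx1 : x < x + 1 by rewrite ltrDl.
have [df <-] := continuous_FTC1 xx1 fi' (ltNyr _) (cf x).
by rewrite derive1E; exact: derivableP.
Qed.

(** Both sides have derivative [x * phi x], and they agree at 0. *)
Lemma Rintegral_tphi x : \int[mu]_(t in `]-oo, x]) (t * phi t) = - phi x.
Proof.
apply/eqP; rewrite -addr_eq0; apply/eqP.
rewrite -[RHS](subrr (phi 0)) [RHS]addrC -Rintegral_tphi_Ny0.
apply: (@is_derive_0_is_cst _ (fun y => \int[mu]_(t in `]-oo, y]) (t * phi t) + phi y)).
move=> y.
have c : continuous (fun t : R => t * phi t : R).
  by move=> t; apply: cvgM; [exact: cvg_id | exact: continuous_phi].
have := is_deriveD (is_derive_Rintegral y itg_tphi c) (is_derive_phi y).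
by rewrite subrr.
Qed.

Lemma Rintegral_tphiT : \int[mu]_t (t * phi t) = 0.
Proof.
have := @Rintegral_itvNyo _ 0 itg_tphi; rewrite Rintegral_tphi.
rewrite Rintegral_itv_obnd_cbnd; last by apply: integrableS itg_tphi.
rewrite {2}/Rintegral integral_tphi0y/=; lra.
Qed.

End gaussian_density.

(** * The solution of the Stein equation *)

Section stein_equation.
Variable R : realType.
Local Notation mu := (@lebesgue_measure R).
Local Notation phi := (normal_pdf (0 : R) 1).
Local Notation Phi x := (\int[mu]_(t in `]-oo, x]) phi t).

Let onex2_gt0 (x : R) : 0 < 1 + x ^+ 2.
Proof. by rewrite ltr_wpDr// sqr_ge0. Qed.

(** The derivative is [2 * phi x / (1 + x ^+ 2) ^+ 2]. Monotonicity on the whole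
line yields both Mills bounds below, by comparison with points far to the left
and far to the right. *)
Lemma Phi_mills_ndecr :
  {homo (fun x : R => Phi x + x * phi x / (1 + x ^+ 2)) : x y / x <= y}.
Proof.
move=> a b ab.
apply: (@derive_ge0_le _ (fun x => Phi x + x * phi x / (1 + x ^+ 2))
  (fun x => 2 * phi x / (1 + x ^+ 2) ^+ 2)) => // [x|].
  have d1 := is_derive_Rintegral x (@itg_phi R) (@continuous_phi R).
  have d2 : is_derive x 1 (fun x : R => (1 + x ^+ 2)^-1)
      (- (1 + x ^+ 2) ^- 2 * (2 * x)).
    have d3 : is_derive x 1 (fun x : R => 1 + x ^+ 2) (2 * x).
      apply: is_derive_eq.
      rewrite /GRing.scale/=; ring.
    have := @is_deriveV R (fun x : R => 1 + x ^+ 2) x _ _ (lt0r_neq0 (onex2_gt0 x)) d3.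
    by [].
  have d4 := is_deriveM (is_deriveM (is_derive_id x (1 : R)) (is_derive_phi x)) d2.
  apply: (is_derive_eq (is_deriveD d1 d4)).
  rewrite /GRing.scale/= -[(id * phi) x]/(x * phi x).
  have H := lt0r_neq0 (onex2_gt0 x).
  by field.
move=> x _; rewrite divr_ge0// ?mulr_ge0// ?exprn_ge0 1?ltW// ?phi_gt0//.
Qed.

Lemma Phi_ge0 x : 0 <= Phi x.
Proof. by apply: Rintegral_ge0 => t _; rewrite ltW// phi_gt0. Qed.

Lemma Phi_tail x : 1 - Phi x = \int[mu]_(t in `]x, +oo[) phi t.
Proof.
by rewrite -{1}(@Rintegral_phi R) Rintegral_itvNyo//; exact: itg_phi.
Qed.

Lemma Phi_le1 x : Phi x <= 1.
Proof.
rewrite -subr_ge0 Phi_tail.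
by apply: Rintegral_ge0 => t _; rewrite ltW// phi_gt0.
Qed.

Let mills_ub (b : R) : 0 < b -> b * phi b / (1 + b ^+ 2) <= normal_peak 1 / b.
Proof.
move=> b0; rewrite ler_pdivrMr// mulrAC ler_pdivlMr//.
have p0 := @normal_peak_ge0 R 1; have := phi_le_peak b; have := phi_gt0 b.
nra.
Qed.

(** Used in place of a passage to the limit [b --> +oo]. *)
Let small_le (a p : R) : 0 <= p -> (forall b, 0 < b -> a <= p / b) -> a <= 0.
Proof.
move=> p0 H; rewrite leNgt; apply/negP => a0.
have b0 : 0 < (p + 1) / a by rewrite divr_gt0// ltr_wpDl.
have := H _ b0; rewrite invf_div mulrA ler_pdivlMr; last by rewrite ltr_wpDl.
nra.
Qed.

(** For [x < 0] this is Mills' inequality at [- x]; for [x >= 0] the left-hand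
side is nonpositive. *)
Lemma Phi_lower_tail (x : R) : - (x * phi x / (1 + x ^+ 2)) <= Phi x.
Proof.
rewrite -subr_le0; apply: (small_le (@normal_peak_ge0 R 1)) => b b0.
have [xb|bx] := leP (- b) x.
  have := Phi_mills_ndecr xb; rewrite /= phiN sqrrN mulNr mulNr.
  have := mills_ub b0; have := Phi_ge0 (- b); lra.
have x0 : 0 < - x by lra.
have := mills_ub x0; rewrite phiN sqrrN mulNr mulNr.
have := Phi_ge0 x.
have : normal_peak 1 / (- x) <= normal_peak 1 / b.
  by rewrite ler_wpM2l ?normal_peak_ge0// lef_pV2// ?posrE//; lra.
lra.
Qed.

Lemma Phi_upper_tail (x : R) : x * phi x / (1 + x ^+ 2) <= 1 - Phi x.
Proof.
rewrite -subr_le0; apply: (small_le (@normal_peak_ge0 R 1)) => b b0.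
have [xb|bx] := leP x b.
  have := Phi_mills_ndecr xb; rewrite /=.
  have := mills_ub b0; have := Phi_le1 b; lra.
have x0 : 0 < x by lra.
have := mills_ub x0; have := Phi_le1 x.
have : normal_peak 1 / x <= normal_peak 1 / b.
  by rewrite ler_wpM2l ?normal_peak_ge0// lef_pV2// ?posrE//; lra.
lra.
Qed.

(** With [F x] the integral up to [x] and [f x = F x / phi x], the left-hand side
is [phi x] times the derivative of [x * f x]. As the total integral vanishes,
[F x] can be read off either tail. If [g x >= 0] then [g >= g x] on the right
tail, if [g x < 0] then [g <= g x] on the left tail, and Mills' bound for the
mass of that tail concludes. *)
Lemma stein_ndecr (g : R -> R) (x : R) :
  {homo g : s t / s <= t} ->
  mu.-integrable setT (EFin \o (fun t => g t * phi t)) ->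
  \int[mu]_t (g t * phi t) = 0 ->
  (1 + x ^+ 2) * \int[mu]_(t in `]-oo, x]) (g t * phi t) + x * g x * phi x <= 0.
Proof.
move=> ndg ig g0.
have igS (D : set R) : measurable D ->
    mu.-integrable D (EFin \o (fun t => g t * phi t)).
  by move=> mD; apply: integrableS ig.
have ipS (D : set R) : measurable D ->
    mu.-integrable D (EFin \o (fun t => g x * phi t)).
  by move=> mD; apply: itgZ => //; apply: integrableS (@itg_phi R).
suff : \int[mu]_(t in `]-oo, x]) (g t * phi t) <= - (x * g x * phi x / (1 + x ^+ 2)).
  rewrite -mulNr ler_pdivlMr//; lra.
have [gx0|gx0] := leP 0 (g x).
  have : g x * (1 - Phi x) <= - \int[mu]_(t in `]-oo, x]) (g t * phi t).
    have := Rintegral_itvNyo x ig; rewrite g0 sub0r => ->.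
    rewrite Phi_tail -RintegralZl//; last by apply: integrableS (@itg_phi R).
    apply: le_Rintegral => //; [exact: ipS|exact: igS|].
    move=> t /=; rewrite in_itv/= andbT => xt.
    by rewrite ler_wpM2r ?normal_pdf_ge0//; apply: ndg; exact: ltW.
  have := ler_wpM2l gx0 (Phi_upper_tail x).
  have -> : x * g x * phi x / (1 + x ^+ 2) = g x * (x * phi x / (1 + x ^+ 2)).
    by rewrite !mulrA (mulrC x).
  lra.
have : \int[mu]_(t in `]-oo, x]) (g t * phi t) <= g x * Phi x.
  rewrite -RintegralZl//; last by apply: integrableS (@itg_phi R).
  apply: le_Rintegral => //; [exact: igS|exact: ipS|].
  move=> t /=; rewrite in_itv/= => xt.
  by rewrite ler_wpM2r ?normal_pdf_ge0// ndg.
have := ler_wnM2l (ltW gx0) (Phi_lower_tail x).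
have -> : x * g x * phi x / (1 + x ^+ 2) = g x * (x * phi x / (1 + x ^+ 2)).
  by rewrite !mulrA (mulrC x).
lra.
Qed.

Lemma itg_lipschitz_phi (h : R -> R) K :
  (forall x y, `|h x - h y| <= K * `|x - y|) ->
  mu.-integrable setT (EFin \o (fun t => h t * phi t)).
Proof.
move=> hK.
have mh := lipschitz_measurable hK.
have H := itgD measurableT (itgZ measurableT K (@itg_normtphi R))
  (itgZ measurableT `|h 0| (@itg_phi R)).
apply: (itg_dom measurableT _ H); first by apply: measurable_funM => //; exact: measurable_phi.
move=> t _; rewrite normrM (gtr0_norm (phi_gt0 _)) mulrA -mulrDl.
rewrite ler_wpM2r ?normal_pdf_ge0//.
by rewrite addrC lipschitz_affine_bound.
Qed.

(** The derivative of [x * f x] lies between [- K] and [K]: apply [stein_ndecr] to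
[K * t + g t] and to [K * t - g t], where the identity contributes [- phi x] to
the integral up to [x]. Since [x * f x] vanishes at 0, being [K]-Lipschitz also
bounds [f], and [f' x = x * f x + g x] is a sum of two [K]-Lipschitz functions. *)
Lemma stein_solution (h : R -> R) K :
  (forall x y, `|h x - h y| <= K * `|x - y|) ->
  exists f f' : R -> R, [/\ forall x, is_derive x (1 : R) f (f' x),
    forall x, f' x = x * f x + (h x - \int[mu]_t (h t * phi t)),
    forall x, `|f x| <= K &
    forall x y, `|f' x - f' y| <= 2 * K * `|x - y|].
Proof.
move=> hK.
have ch : continuous h := lipschitz_continuous hK.
set c := \int[mu]_t (h t * phi t).
pose g t := h t - c.
have gK x y : `|g x - g y| <= K * `|x - y|.
  by rewrite (_ : g x - g y = h x - h y) ?hK// /g; ring.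
have ig : mu.-integrable setT (EFin \o (fun t => g t * phi t)).
  exact: itg_lipschitz_phi gK.
have g0 : \int[mu]_t (g t * phi t) = 0.
  under eq_Rintegral do rewrite mulrBl.
  rewrite RintegralB//; [|exact: itg_lipschitz_phi hK|].
    rewrite RintegralZl//; last exact: itg_phi.
    by rewrite Rintegral_phi mulr1 subrr.
  by apply: itgZ => //; exact: itg_phi.
pose F x := \int[mu]_(t in `]-oo, x]) (g t * phi t).
pose f x := F x / phi x.
pose f' x := x * f x + g x.
have key x : `|(1 + x ^+ 2) * F x + x * g x * phi x| <= K * phi x.
  (* The two values of [s] give the two sides of the absolute value. *)
  have half (s : R) : s ^+ 2 = 1 ->
      s * ((1 + x ^+ 2) * F x + x * g x * phi x) <= K * phi x.
    move=> s2.
    have isg : mu.-integrable setT (EFin \o (fun t => s * (g t * phi t))).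
      exact: itgZ.
    have iK : mu.-integrable setT (EFin \o (fun t => K * (t * phi t))).
      by apply: itgZ => //; exact: itg_tphi.
    have split_ t : (K * t + s * g t) * phi t = K * (t * phi t) + s * (g t * phi t).
      by rewrite mulrDl !mulrA.
    have s1 := normr_sqr1 s2.
    have := @stein_ndecr (fun t => K * t + s * g t) x.
    have -> : \int[mu]_(t in `]-oo, x]) ((K * t + s * g t) * phi t) =
        - K * phi x + s * F x.
      under eq_Rintegral do rewrite split_.
      rewrite RintegralD//; [|by apply: integrableS iK|by apply: integrableS isg].
      rewrite !RintegralZl//; [|by apply: integrableS (@itg_tphi R)|by apply: integrableS ig].
      by rewrite Rintegral_tphi mulrN mulNr.
    move=> /(_ _ _ _)H.
    suff : (1 + x ^+ 2) * (- K * phi x + s * F x) +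
       x * (K * x + s * g x) * phi x <= 0 by lra.
    apply: H.
    - move=> a b ab.
      have := gK b a; rewrite -[`|_|]mul1r -s1 -normrM (@ger0_norm _ (b - a)) ?subr_ge0//.
      rewrite ler_norml mulrBr => /andP[]; lra.
    - apply: eq_integrable (itgD measurableT iK isg) => //.
      by move=> t _ /=; rewrite -split_.
    - under eq_Rintegral do rewrite split_.
      rewrite RintegralD// !RintegralZl//; [|exact: itg_tphi].
      by rewrite g0 Rintegral_tphiT !mulr0 addr0.
  rewrite ler_norml; have := half 1 (expr1n _ _); have := half (- 1) (sqrr_sign _ 1).
  lra.
have dF (x : R) : is_derive x 1 F (g x * phi x).
  apply: (is_derive_Rintegral x ig) => t.
  by apply: cvgM; [exact: (lipschitz_continuous gK)|exact: continuous_phi].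
have df (x : R) : is_derive x 1 f (f' x).
  have phi0 := lt0r_neq0 (phi_gt0 x).
  have dV := @is_deriveV R phi x _ _ phi0 (is_derive_phi x).
  apply: (is_derive_eq (is_deriveM (dF x) dV)).
  by rewrite /GRing.scale/= /f' /f; field.
have key' x : `|f x + x * f' x| <= K.
  rewrite -(ler_pM2r (phi_gt0 x)) -{1}(gtr0_norm (phi_gt0 x)) -normrM.
  rewrite (_ : (f x + x * f' x) * phi x = (1 + x ^+ 2) * F x + x * g x * phi x) ?key//.
  by have phi0 := lt0r_neq0 (phi_gt0 x); rewrite /f' /f; field.
have xfK x y : `|x * f x - y * f y| <= K * `|x - y|.
  apply: (@derive_bounded_lipschitz R (fun t => t * f t)
    (fun t => f t + t * f' t)) => [t|]; last exact: key'.
  apply: (is_derive_eq (is_deriveM (is_derive_id t (1 : R)) (df t))).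
  by rewrite /GRing.scale/= mulr1 addrC.
exists f, f'; split => // x.
  have [->|x0] := eqVneq x 0.
    by have := key' 0; rewrite mul0r addr0.
  have := xfK x 0; rewrite mul0r !subr0 normrM mulrC.
  by rewrite ler_pM2r// normr_gt0.
move=> y; rewrite /f' opprD addrACA (le_trans (ler_normD _ _))//.
have := xfK x y; have := gK x y; lra.
Qed.

End stein_equation.

(** * The defect of the Stein identity for one variable *)

Section trapezoid.
Variables (R : realType) (G g : R -> R) (M : R).
Hypothesis dG : forall x, is_derive x (1 : R) G (g x).
Hypothesis gM : forall x y, `|g x - g y| <= M * `|x - y|.

(** The remainder bound [k], a function of [t], vanishes at [a] and its derivative
has the sign of [t - a]. *)
Lemma taylor1_lipschitz a b :
  `|G b - G a - g a * (b - a)| <= M / 2 * (b - a) ^+ 2.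
Proof.
pose k (s t : R) := M / 2 * (t - a) ^+ 2 + s * (G t - G a - g a * (t - a)).
pose dk (s t : R) := M * (t - a) + s * (g t - g a).
have kd s t : is_derive t (1 : R) (k s) (dk s t).
  have d1 : is_derive t 1 (fun t : R => G t - G a - g a * (t - a)) (g t - g a).
    by apply: is_derive_eq; rewrite /GRing.scale/=; ring.
  by apply: is_derive_eq; rewrite /GRing.scale/= /dk; field.
have half s : s ^+ 2 = 1 -> 0 <= k s b.
  move=> s2.
  have s1 := normr_sqr1 s2.
  have ka : k s a = 0 by rewrite /k !subrr expr0n/= !mulr0 subr0 mulr0 addr0.
  have B t : `|s * (g t - g a)| <= M * `|t - a| by rewrite normrM s1 mul1r.
  have [ab|ba] := leP a b.
    rewrite -ka; apply: (derive_ge0_le ab (kd s)) => t /andP[ta _].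
    have := B t; rewrite ler_norml (@gtr0_norm _ (t - a)) ?subr_gt0// /dk => /andP[].
    lra.
  rewrite -oppr_le0 -oppr0 -ka.
  apply: (@derive_ge0_le _ (fun t => - k s t) (fun t => - dk s t) _ _ (ltW ba)) => t.
  move=> /andP[_ ta].
  have := B t; rewrite ler_norml (@ltr0_norm _ (t - a)) ?subr_lt0// /dk => /andP[].
  lra.
rewrite ler_norml; have := half 1 (expr1n _ _); have := half (- 1) (sqrr_sign _ 1).
rewrite /k; lra.
Qed.

(** The constant 1/4 of the trapezoidal rule for a Lipschitz integrand comes from
expanding [G] at each endpoint only up to the midpoint. *)
Lemma trapezoid_lipschitz x y :
  `|G x - G y - (x - y) * (g x + g y) / 2| <= M / 4 * (x - y) ^+ 2.
Proof.
have := taylor1_lipschitz x ((x + y) / 2).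
have := taylor1_lipschitz y ((x + y) / 2).
rewrite !ler_norml; lra.
Qed.

(** On the diagonal [x = y] the left-hand side vanishes, which prevents the mixed
monomials from having a larger coefficient than the cubes. For [|y| <= x], 32 times
the difference of the two sides is [(x - y)^2 (x + 9 y)] when [y >= 0] and
[((x + 4 y)^2 + y^2) (x - y)] when [y < 0]. *)
Lemma cubic_bound (x y : R) :
  `|x - y| ^+ 3 / 8 + (x - y) ^+ 2 * `|x + y| / 4 <=
  13 / 32 * (`|x| ^+ 3 + `|y| ^+ 3 - x * y * (`|x| + `|y|)).
Proof.
wlog yx : x y / `|y| <= `|x| => [H|].
  have [yx|xy] := leP `|y| `|x|; first exact: H.
  have := H y x (ltW xy).
  rewrite (distrC y x) (addrC y x) (_ : (y - x) ^+ 2 = (x - y) ^+ 2); last by ring.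
  by rewrite (addrC (`|y| ^+ 3)) (addrC `|y|) (mulrC y).
wlog x0 : x y yx / 0 <= x => [H|].
  have [x0|x0] := leP 0 x; first exact: H.
  have := H (- x) (- y); rewrite !normrN yx => /(_ isT).
  rewrite oppr_ge0 ltW// => /(_ isT).
  by rewrite -!opprD !normrN sqrrN mulrNN.
rewrite (ger0_norm x0) in yx *.
have [y0|y0] := leP 0 y.
  rewrite (ger0_norm y0) in yx *.
  rewrite !ger0_norm ?subr_ge0 ?addr_ge0// -subr_ge0.
  have -> : 13 / 32 * (x ^+ 3 + y ^+ 3 - x * y * (x + y)) -
     ((x - y) ^+ 3 / 8 + (x - y) ^+ 2 * (x + y) / 4) =
     (x - y) ^+ 2 * (x + 9 * y) / 32 by field.
  by rewrite divr_ge0// mulr_ge0 ?sqr_ge0// addr_ge0// mulr_ge0.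
rewrite (ltr0_norm y0) in yx *.
have xy0 : 0 <= x + y by lra.
rewrite !ger0_norm//; last by lra.
rewrite -subr_ge0.
have -> : 13 / 32 * (x ^+ 3 + (- y) ^+ 3 - x * y * (x - y)) -
     ((x - y) ^+ 3 / 8 + (x - y) ^+ 2 * (x + y) / 4) =
     ((x + 4 * y) ^+ 2 * (x - y) + (- y) ^+ 2 * (x - y)) / 32 by field.
rewrite divr_ge0// addr_ge0// mulr_ge0 ?sqr_ge0//; lra.
Qed.

(** Averaged over two independent copies [x], [y] of a standardized variable, the
expression in the norm becomes the mean of [x * G x] minus that of [g x]: all the
products of a centred factor and a function of the other variable disappear. It
splits into [(x - y) / 2] times the trapezoidal error and
[(x ^+ 2 - y ^+ 2) / 4 * (g x - g y)]. *)
Lemma symmetrized_kernel_bound (x y : R) : 0 <= M ->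
  `| (x * G x + y * G y - x * G y - y * G x) / 2
     - (y ^+ 2 * g x + x ^+ 2 * g y) / 2 + x * y * (g x + g y) / 2 | <=
  M * (13 / 32 * (`|x| ^+ 3 + `|y| ^+ 3 - x * y * (`|x| + `|y|))).
Proof.
move=> M0; apply: le_trans (ler_wpM2l M0 (cubic_bound x y)).
have -> : (x * G x + y * G y - x * G y - y * G x) / 2
     - (y ^+ 2 * g x + x ^+ 2 * g y) / 2 + x * y * (g x + g y) / 2 =
  (x - y) / 2 * (G x - G y - (x - y) * (g x + g y) / 2) +
  (x - y) * (x + y) / 4 * (g x - g y) by field.
apply: (le_trans (ler_normD _ _)); rewrite [leRHS]mulrDr; apply: lerD.
  rewrite normrM [`|(x - y) / 2|]normrM (@ger0_norm _ 2^-1)//.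
  have := ler_wpM2l (normr_ge0 (x - y)) (trapezoid_lipschitz x y).
  have -> : `|x - y| ^+ 3 = `|x - y| * (x - y) ^+ 2.
    by rewrite -(@real_normK _ (x - y)) ?num_real// exprS.
  lra.
rewrite normrM ![`|_ / 4|]normrM [`|(x - y) * _|]normrM (@ger0_norm _ 4^-1)//.
have := ler_wpM2l (mulr_ge0 (normr_ge0 (x - y)) (normr_ge0 (x + y))) (gM x y).
rewrite -(@real_normK _ (x - y)) ?num_real// expr2; lra.
Qed.

End trapezoid.

Section linear_combinations.
Context d (T : measurableType d) (R : realType).
Variable mu : {measure set T -> \bar R}.
Local Notation itg f := (mu.-integrable setT (EFin \o f)).

(** The integrability hypotheses are a fold so that, for an explicit list, they
compute to a conjunction. *)
Lemma Rintegral_lin (s : seq (R * (T -> R))) (f : T -> R) :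
  foldr (fun p Q => itg p.2 /\ Q) True s ->
  (forall x, f x = \sum_(p <- s) p.1 * p.2 x) ->
  itg f /\ \int[mu]_x f x = \sum_(p <- s) p.1 * \int[mu]_x p.2 x.
Proof.
elim: s f => [|[c u] s IH] f /= si fE.
  rewrite (_ : f = cst 0); last by apply/funext => x; rewrite fE big_nil.
  by rewrite big_nil Rintegral_cst// mul0r; split => //; exact: integrable0.
have [iu si'] := si.
have [ir rE] := IH (fun x => \sum_(p <- s) p.1 * p.2 x) si' (fun _ => erefl).
rewrite (_ : f = fun x => c * u x + \sum_(p <- s) p.1 * p.2 x); last first.
  by apply/funext => x; rewrite fE big_cons.
split; first by apply: itgD => //; exact: itgZ.
by rewrite RintegralD ?RintegralZl ?rE ?big_cons//; exact: itgZ.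
Qed.

End linear_combinations.

Section standardized_variable.
Context d (T : measurableType d) (R : realType) (P : probability T R).
Local Notation itg f := (P.-integrable setT (EFin \o f)).

Definition standardized (X : T -> R) :=
  [/\ measurable_fun setT X, itg (fun w => `|X w| ^+ 3),
      \int[P]_w X w = 0 & \int[P]_w (X w ^+ 2) = 1].

Lemma itg_cst (c : R) : itg (fun=> c).
Proof. exact: finite_measure_integrable_cst. Qed.

Lemma Rintegral_prob_cst (c : R) : \int[P]_w c = c.
Proof. by rewrite /Rintegral integral_cst//= probability_setT mule1. Qed.

Variables (X : T -> R) (sX : standardized X).

Let mX : measurable_fun setT X. Proof. by case: sX. Qed.

Lemma standardized_itg (f : R -> R) (c : R) : measurable_fun setT f ->
  (forall x, `|f x| <= c * (1 + `|x| ^+ 3)) -> itg (fun w => f (X w)).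
Proof.
move=> mf fc; have [_ iX3 _ _] := sX.
apply: (itg_dom measurableT _ (itgZ measurableT c (itgD measurableT (itg_cst 1) iX3))).
  exact: measurableT_comp.
by move=> w _; exact: fc.
Qed.

Let pow_le (x : R) : 0 <= x -> x <= 1 + x ^+ 3 /\ x ^+ 2 <= 1 + x ^+ 3.
Proof.
move=> x0; have h : 0 <= (x - 1) ^+ 2 * (x + 1) by rewrite mulr_ge0 ?sqr_ge0// addr_ge0.
have h2 := sqr_ge0 x.
by split; lra.
Qed.

Lemma standardized_itg1 : itg X.
Proof.
apply: (@standardized_itg id 1) => // x.
by rewrite mul1r; have [] := pow_le (normr_ge0 x).
Qed.

Lemma standardized_itg2 : itg (fun w => X w ^+ 2).
Proof.
apply: (@standardized_itg (fun x => x ^+ 2) 1) => [|x].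
  exact: exprn_measurable.
by rewrite mul1r normrX; have [] := pow_le (normr_ge0 x).
Qed.

(** From [2 t^3 - 3 t^2 + 1 = (t - 1)^2 (2 t + 1)] at [t = |X w|]. *)
Lemma standardized_third_ge1 : 1 <= \int[P]_w (`|X w| ^+ 3).
Proof.
have [_ iX3 _ X2] := sX.
apply: (@le_trans _ _ (\int[P]_w (- 2^-1 * 1 + 3 / 2 * X w ^+ 2))); last first.
  apply: le_Rintegral => //.
  - apply: itgD => //; apply: itgZ => //; first exact: itg_cst.
    exact: standardized_itg2.
  - move=> w _; have : 0 <= (`|X w| - 1) ^+ 2 * (`|X w| + 2^-1).
      by rewrite mulr_ge0 ?sqr_ge0// addr_ge0.
    have := @real_normK _ (X w) (num_real _).
    lra.
have [||_ ->] := @Rintegral_lin _ _ _ P [:: (- 2^-1, fun=> 1); (3 / 2, fun w => X w ^+ 2)]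
    (fun w => - 2^-1 * 1 + 3 / 2 * X w ^+ 2).
- by do !split => //=; [exact: itg_cst|exact: standardized_itg2].
- by move=> x; rewrite !big_cons big_nil/= addr0.
by rewrite !big_cons big_nil/= Rintegral_prob_cst X2; lra.
Qed.

(** The kernel of [symmetrized_kernel_bound] is a finite sum of products of a
function of [x] and a function of [y]. Averaging over an independent copy thus
amounts to integrating in [x] for fixed [y], which gives the function [k1], and
then in [y], without any product measure. *)
Lemma stein_identity_defect (G g : R -> R) (M B : R) :
  (forall x, is_derive x (1 : R) G (g x)) ->
  (forall x y, `|g x - g y| <= M * `|x - y|) -> 0 <= M ->
  (forall x, `|G x| <= B) ->
  `| \int[P]_w (X w * G (X w)) - \int[P]_w g (X w) | <=
  13 / 16 * M * \int[P]_w (`|X w| ^+ 3).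
Proof.
move=> dG gM M0 GB; have [_ iX3 X1 X2] := sX.
have B0 : 0 <= B := le_trans (normr_ge0 _) (GB 0).
have mG := continuous_measurable_fun (is_derive1_continuous dG).
have mg := lipschitz_measurable gM.
have gb := lipschitz_affine_bound gM.
have i1 := standardized_itg1.
have i2 := standardized_itg2.
have ic := itg_cst 1.
have iXX : itg (fun w => X w * `|X w|).
  apply: (@standardized_itg (fun x => x * `|x|) 1) => [|x].
    by apply: measurable_funM => //; exact: normr_measurable.
  by rewrite mul1r normrM normr_id -expr2; have [] := pow_le (normr_ge0 x).
have iG : itg (fun w => G (X w)).
  apply: (@standardized_itg G B) => // x.
  by rewrite (le_trans (GB _))// ler_peMr// lerDl exprn_ge0.
have iXG : itg (fun w => X w * G (X w)).
  apply: (@standardized_itg (fun x => x * G x) B) => [|x].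
    exact: measurable_funM.
  rewrite normrM mulrC ler_pM//.
  by have [] := pow_le (normr_ge0 x).
have ig : itg (fun w => g (X w)).
  apply: (@standardized_itg g (`|g 0| + M)) => // x.
  apply: (le_trans (gb _)); rewrite mulrDl lerD//.
    by rewrite ler_peMr// lerDl exprn_ge0.
  by rewrite ler_wpM2l//; have [] := pow_le (normr_ge0 x).
have iXg : itg (fun w => X w * g (X w)).
  apply: (@standardized_itg (fun x => x * g x) (`|g 0| + M)) => // [|x].
    exact: measurable_funM.
  have [h1 h2] := pow_le (normr_ge0 x).
  rewrite normrM; have := ler_wpM2l (normr_ge0 x) (gb x).
  have := ler_wpM2l (normr_ge0 (g 0)) h1; have := ler_wpM2l M0 h2; lra.
pose C := M * (13 / 32).
set rho := \int[P]_w (`|X w| ^+ 3).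
pose a := \int[P]_w (X w * `|X w|).
set al := \int[P]_w (X w * G (X w)).
pose be := \int[P]_w G (X w).
set ga := \int[P]_w g (X w).
pose de := \int[P]_w (X w * g (X w)).
have half s : s ^+ 2 = 1 -> 0 <= 2 * C * rho - s * (al - ga).
  move=> s2.
  have s1 := normr_sqr1 s2.
  pose k x y := C * (`|x| ^+ 3 + `|y| ^+ 3 - x * y * (`|x| + `|y|))
    - s * ((x * G x + y * G y - x * G y - y * G x) / 2
       - (y ^+ 2 * g x + x ^+ 2 * g y) / 2 + x * y * (g x + g y) / 2).
  have k0 x y : 0 <= k x y.
    rewrite subr_ge0 (le_trans (ler_norm _))// normrM s1 mul1r /C -[leRHS]mulrA.
    exact: symmetrized_kernel_bound.
  pose k1 y := C * rho + (C * `|y| ^+ 3 - s * y * G y / 2) - C * y * a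
    - s / 2 * al + s * y / 2 * be + s * y ^+ 2 / 2 * ga + s * g y / 2
    - s * y / 2 * de.
  have k10 y : 0 <= k1 y.
    have [||_ kE] := @Rintegral_lin _ _ _ P [:: (C, fun w => `|X w| ^+ 3);
      (C * `|y| ^+ 3 - s * y * G y / 2, fun=> 1);
      (- C * y, fun w => X w * `|X w|);
      (- C * y * `|y| + s * G y / 2 - s * y * g y / 2, X);
      (- s / 2, fun w => X w * G (X w)); (s * y / 2, fun w => G (X w));
      (s * y ^+ 2 / 2, fun w => g (X w)); (s * g y / 2, fun w => X w ^+ 2);
      (- s * y / 2, fun w => X w * g (X w))] (fun w => k (X w) y).
    - by do !split.
    - by move=> w; rewrite !big_cons big_nil /k/=; field.
    have : 0 <= \int[P]_w k (X w) y by exact: Rintegral_ge0.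
    rewrite kE !big_cons big_nil/= Rintegral_prob_cst X1 X2.
    rewrite -/rho -/a -/al -/be -/ga -/de /k1; lra.
  have [||_ kE] := @Rintegral_lin _ _ _ P [:: (C, fun w => `|X w| ^+ 3);
      (C * rho - s / 2 * al, fun=> 1);
      (- C * a + s / 2 * be - s / 2 * de, X);
      (- s / 2, fun w => X w * G (X w));
      (s / 2 * ga, fun w => X w ^+ 2); (s / 2, fun w => g (X w))]
      (fun w => k1 (X w)).
  - by do !split.
  - by move=> w; rewrite !big_cons big_nil /k1/=; field.
  have : 0 <= \int[P]_w k1 (X w) by exact: Rintegral_ge0.
  rewrite kE !big_cons big_nil/= Rintegral_prob_cst X1 X2.
  rewrite -/rho -/al -/ga; lra.
rewrite ler_norml; have := half 1 (expr1n _ _); have := half (- 1) (sqrr_sign _ 1).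
rewrite /C; lra.
Qed.

End standardized_variable.

(** * Independence *)

Section independence.
Context d (T : measurableType d) (R : realType) (P : probability T R).
Local Notation RR := (measurableTypeR R).
Implicit Types U V : T -> R.

Definition indep2 U V := forall A B : set R, measurable A -> measurable B ->
  P (U @^-1` A `&` V @^-1` B) = (P (U @^-1` A) * P (V @^-1` B))%E.

Lemma measurable_preimage U (A : set R) : measurable_fun setT U -> measurable A ->
  measurable (U @^-1` A).
Proof. by move=> mU mA; rewrite -[X in measurable X]setTI; exact: mU. Qed.

Lemma measurable_pair U V : measurable_fun setT U -> measurable_fun setT V ->
  measurable_fun setT (fun w => (U w, V w) : (RR * RR)%type).
Proof. by move=> mU mV; exact: measurable_fun_pair. Qed.

Lemma eq_indep2 U U' V V' : U =1 U' -> V =1 V' ->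
  indep2 U V -> indep2 U' V'.
Proof. by move=> /funext <- /funext <-. Qed.

Lemma indep2_comp U V (f g : R -> R) :
  measurable_fun setT f -> measurable_fun setT g -> indep2 U V ->
  indep2 (f \o U) (g \o V).
Proof.
move=> mf mg UV A B mA mB.
have mfA : measurable (f @^-1` A) by rewrite -[X in measurable X]setTI; exact: mf.
have mgB : measurable (g @^-1` B) by rewrite -[X in measurable X]setTI; exact: mg.
exact: (UV _ _ mfA mgB).
Qed.

(** As functions of [C] both sides are finite measures, and the rectangles form a
generating family that is stable under intersection. *)
Lemma indep_event_pair (E : set T) U V : measurable E ->
  measurable_fun setT U -> measurable_fun setT V ->
  (forall A B : set R, measurable A -> measurable B ->
    P (E `&` (U @^-1` A `&` V @^-1` B)) = (P E * P (U @^-1` A `&` V @^-1` B))%E) ->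
  forall C : set (RR * RR), measurable C ->
  P (E `&` [set w | C (U w, V w)]) = (P E * P [set w | C (U w, V w)])%E.
Proof.
move=> mE mU mV rect C mC.
pose UV w : (RR * RR)%type := (U w, V w).
have mUV : measurable_fun setT UV := measurable_pair mU mV.
have c0 : 0 <= fine (P E) by rewrite fine_ge0.
pose m1 : {measure set (RR * RR) -> \bar R} := pushforward (mrestr P mE) UV.
pose m2 : {measure set (RR * RR) -> \bar R} := mscale (NngNum c0) (pushforward P UV).
have PE : (fine (P E))%:E = P E by rewrite fineK// fin_num_measure.
have m1E A : m1 mUV A = P (E `&` UV @^-1` A) by rewrite setIC.
have m2E A : m2 mUV A = (P E * P (UV @^-1` A))%E by rewrite -PE.
rewrite -[LHS]m1E -[RHS]m2E.
pose G : set (set (RR * RR)) := [set A `*` B | A in measurable & B in measurable].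
apply: (measure_unique G (fun=> setT)) => //.
- by rewrite measurable_prod_measurableType.
- move=> _ _ [A1 mA1 [B1 mB1 <-]] [A2 mA2 [B2 mB2 <-]].
  rewrite -setXI; exists (A1 `&` A2); first exact: measurableI.
  by exists (B1 `&` B2) => //; exact: measurableI.
- by move=> _; exists setT => //; exists setT => //; rewrite setXTT.
- by rewrite bigcup_const.
- move=> _ [A mA [B mB <-]].
  rewrite m1E m2E.
  exact: rect.
- by move=> _; rewrite m1E preimage_setT setIT (le_lt_trans (probability_le1 _ _)) ?ltry.
Qed.

Section joint_law.
Variables (U V : T -> R).
Hypotheses (mU : measurable_fun setT U) (mV : measurable_fun setT V).
Hypothesis UV : indep2 U V.

Let Um : {mfun T >-> RR} := HB.pack (U : T -> RR) (isMeasurableFun.Build _ _ _ _ (U : T -> RR) mU).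
Let Vm : {mfun T >-> RR} := HB.pack (V : T -> RR) (isMeasurableFun.Build _ _ _ _ (V : T -> RR) mV).
Let UVm : {mfun T >-> (RR * RR)%type} := HB.pack (fun w => (U w, V w) : (RR * RR)%type)
  (isMeasurableFun.Build _ _ _ _ (fun w => (U w, V w) : (RR * RR)%type) (measurable_pair mU mV)).

Let lawE A : measurable A ->
  (distribution P Um \x distribution P Vm)%E A = distribution P UVm A.
Proof.
by move=> mA; apply: (@product_measure_unique _ _ _ _ R (distribution P Um)
  (distribution P Vm) (distribution P UVm)).
Qed.

(** The inner integral runs over the same probability space: it averages over an
independent copy of [V]. *)
Lemma indep2_tonelli (k : RR * RR -> \bar R) : measurable_fun setT k ->
  (forall z, (0 <= k z)%E) ->
  (\int[P]_w k (U w, V w) = \int[P]_w \int[P]_w' k (U w, V w'))%E.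
Proof.
move=> mk k0.
have -> : (\int[P]_w k (U w, V w) = \int[distribution P UVm]_z k z)%E.
  by rewrite ge0_integral_distribution.
rewrite -(@eq_measure_integral _ _ _ _ (distribution P UVm)
    (distribution P Um \x distribution P Vm)%E); last first.
  by move=> A mA _; exact: lawE.
rewrite fubini_tonelli1// /fubini_F ge0_integral_distribution//; first last.
- by move=> x; exact: integral_ge0.
- exact: measurable_fun_fubini_tonelli_F.
apply: eq_integral => w _ /=; rewrite ge0_integral_distribution//.
exact: measurableT_comp.
Qed.

Lemma indep2_fubini (k : RR * RR -> R) : measurable_fun setT k ->
  P.-integrable setT (EFin \o (fun w => k (U w, V w))) ->
  (forall u, P.-integrable setT (EFin \o (fun w => k (u, V w)))) ->
  P.-integrable setT (EFin \o (fun w => \int[P]_w' k (U w, V w'))) /\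
  \int[P]_w k (U w, V w) = \int[P]_w \int[P]_w' k (U w, V w').
Proof.
move=> mk ik iku.
have mEk : measurable_fun setT (EFin \o k) by exact/measurable_EFinP.
have ilaw : (distribution P Um \x distribution P Vm)%E.-integrable setT (EFin \o k).
  have i2 : (distribution P UVm).-integrable setT (EFin \o k).
    by apply: integrable_pushforward.
  apply/integrableP; split => //.
  rewrite (@eq_measure_integral _ _ _ _ (distribution P UVm)
    (distribution P Um \x distribution P Vm)%E); last first.
    by move=> A mA _; exact: lawE.
  by have /integrableP[] := i2.
have FE u : fubini_F (distribution P Vm) (EFin \o k) u = (\int[P]_w' k (u, V w'))%:E.
  rewrite /fubini_F integral_distribution; last exact: iku.
    by rewrite /Rintegral fineK//; exact: integrable_fin_num (iku u).
  exact: measurableT_comp.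
have FI := integrable_fubini_F ilaw.
have EF : fubini_F (distribution P Vm) (EFin \o k) = (fun u => (\int[P]_w' k (u, V w'))%:E).
  by apply/funext.
have mF : measurable_fun setT (fun u : RR => (\int[P]_w' k (u, V w'))%:E).
  by rewrite -EF; exact: measurable_int FI.
have iF : P.-integrable setT (EFin \o (fun w => \int[P]_w' k (U w, V w'))).
  apply/integrableP; split; first exact: (measurableT_comp mF mU).
  have /integrableP[_] := FI.
  rewrite EF ge0_integral_distribution//.
  exact: measurableT_comp.
split => //; congr fine.
have -> : (\int[P]_w (k (U w, V w))%:E = \int[distribution P UVm]_z (k z)%:E)%E.
  by rewrite integral_distribution.
rewrite -(@eq_measure_integral _ _ _ _ (distribution P UVm)
    (distribution P Um \x distribution P Vm)%E); last first.
  by move=> A mA _; exact: lawE.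
rewrite -(integral12_prod_meas1 ilaw) EF integral_distribution//.
Qed.

End joint_law.

Lemma indep2_expectation_mul U V :
  measurable_fun setT U -> measurable_fun setT V -> indep2 U V ->
  (forall w, 0 <= U w) -> (forall w, 0 <= V w) ->
  P.-integrable setT (EFin \o U) -> P.-integrable setT (EFin \o V) ->
  \int[P]_w (U w * V w) = (\int[P]_w U w) * (\int[P]_w V w).
Proof.
move=> mU mV UV U0 V0 iU iV.
pose k (z : RR * RR) : \bar R := (`|z.1| * `|z.2|)%:E.
have mk : measurable_fun setT k.
  apply/measurable_EFinP; apply: measurable_funM.
    by apply: measurableT_comp => //; exact: (@measurable_fst _ _ RR RR).
  by apply: measurableT_comp => //; exact: (@measurable_snd _ _ RR RR).
have k0 z : (0 <= k z)%E by rewrite lee_fin mulr_ge0.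
have := indep2_tonelli mU mV UV mk k0.
rewrite /k/= => H; rewrite {1}/Rintegral.
under eq_integral do rewrite -(ger0_norm (U0 _)) -(ger0_norm (V0 _)).
rewrite H.
transitivity (\int[P]_w (U w * (\int[P]_w' V w'))); last by rewrite RintegralZr.
congr fine; apply: eq_integral => w _.
under eq_integral do rewrite (ger0_norm (U0 _)) (ger0_norm (V0 _)) EFinM.
rewrite integralZl// EFinM; congr (_ * _)%E.
by rewrite /Rintegral fineK//; exact: integrable_fin_num.
Qed.

End independence.

Section independent_sums.
Context d (T : measurableType d) (R : realType) (P : probability T R).
Variables (I : finType) (X : I -> {RV P >-> R}).
Hypothesis indX : mutually_independent X.

Let event_indep (J : {set I}) (E : set T) := forall (K : {set I}) (A : I -> set R),
  K \subset J -> (forall i, measurable (A i)) ->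
  P (E `&` \bigcap_(i in [set` K]) X i @^-1` A i) =
  (P E * \prod_(i in K) P (X i @^-1` A i))%E.

Let mXA i (A : set R) : measurable A -> measurable (X i @^-1` A).
Proof. by move=> mA; exact: measurable_preimage. Qed.

Let mcap (K : {set I}) (A : I -> set R) : (forall i, measurable (A i)) ->
  measurable (\bigcap_(i in [set` K]) X i @^-1` A i).
Proof.
move=> mA; apply: fin_bigcap_measurable => // i _; exact: mXA.
Qed.

Let event_indep_setT : event_indep [set: I]%SET setT.
Proof. by move=> K A _ mA; rewrite setTI probability_setT mul1e indX. Qed.

Let event_indep_cap J E i (B : set R) : event_indep J E -> i \in J -> measurable B ->
  P (E `&` X i @^-1` B) = (P E * P (X i @^-1` B))%E /\
  event_indep (J :\ i)%SET (E `&` X i @^-1` B).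
Proof.
move=> fE iJ mB.
have PEB : P (E `&` X i @^-1` B) = (P E * P (X i @^-1` B))%E.
  have := fE [set i]%SET (fun=> B); rewrite finset.sub1set => /(_ iJ (fun=> mB)).
  rewrite big_set1 => <-; congr (P (_ `&` _)).
  apply/seteqP; split => w /= h; first by move=> j /=; rewrite inE => /eqP ->.
  by apply: h; rewrite /= inE.
split => // K A KJ mA; rewrite PEB.
pose A' j := if j == i then B else A j.
have iK : i \notin K by apply/negP => /(fintype.subsetP KJ); rewrite !inE eqxx.
have := fE (i |: K)%SET A'; rewrite finset.subUset finset.sub1set iJ/=.
rewrite (fintype.subset_trans KJ (finset.subD1set _ _)) => /(_ isT).
have mA' j : measurable (A' j) by rewrite /A'; case: ifP.
move=> /(_ mA'); rewrite big_setU1//= {2}/A' eqxx muleA.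
have -> : (\prod_(j in K) P (X j @^-1` A' j) = \prod_(j in K) P (X j @^-1` A j))%E.
  apply: eq_bigr => j jK; rewrite /A' ifF//.
  by apply: contraNF iK => /eqP <-.
move=> <-; congr (P _); rewrite -setIA; congr (_ `&` _).
apply/seteqP; split => w /=.
  move=> [Bw Aw] j /=; rewrite inE => /orP[|jK].
    by rewrite inE => /eqP ->; rewrite /A' eqxx.
  by rewrite /A' ifF; [exact: Aw|apply: contraNF iK => /eqP <-].
move=> h; split.
  by have := h i; rewrite /= !inE eqxx /A' eqxx; apply.
move=> j /= jK; have := h j; rewrite /= !inE jK orbT /A' ifF; first by apply.
by apply: contraNF iK => /eqP <-.
Qed.

Let event_indep_bigcap (K : {set I}) (C : I -> set R) : (forall i, measurable (C i)) ->
  event_indep (~: K)%SET (\bigcap_(i in [set` K]) X i @^-1` C i).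
Proof.
move=> mC L A LK mA.
pose B i := if i \in K then C i else A i.
have LnK i : i \in L -> (i \in K) = false.
  by move=> iL; have := fintype.subsetP LK _ iL; rewrite inE => /negbTE.
have mB i : measurable (B i) by rewrite /B; case: ifP.
rewrite indX//; have := indX (K :|: L)%SET mB.
have -> : \bigcap_(i in [set` (K :|: L)%SET]) X i @^-1` B i =
    (\bigcap_(i in [set` K]) X i @^-1` C i) `&` (\bigcap_(i in [set` L]) X i @^-1` A i).
  apply/seteqP; split => w /=.
    move=> h; split => i /= iK; have := h i; rewrite /= inE iK ?orbT /B.
      by rewrite iK; apply.
    by rewrite LnK//; apply.
  move=> [h1 h2] i /=; rewrite inE => /orP[iK|iL]; rewrite /B.
    by rewrite iK; exact: h1.
  by rewrite LnK//; exact: h2.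
move=> ->.
rewrite (eq_bigl [predU K & L]); last by move=> i; rewrite !inE.
rewrite bigU/=; last first.
  by rewrite disjoint_sym disjoint_subset; apply/fintype.subsetP => i /LnK; rewrite inE => ->.
congr (_ * _)%E; apply: eq_bigr => i; rewrite /B; first by move=> ->.
by move=> /LnK ->.
Qed.

Let S (s : seq I) w := \sum_(i <- s) X i w.

Let mS s : measurable_fun setT (S s).
Proof. by apply: measurable_sum => i; exact: measurable_funPT. Qed.

(** One variable is added at a time: the induction hypothesis, used for [E] and
for the whole space, each time intersected with an event of [X i], shows that [E]
is independent of the pair formed by [X i] and the sum of the other terms. *)
Let event_indep_sum s : uniq s ->
  forall (J : {set I}) (E : set T) (B : set R), {subset s <= J} ->
  event_indep J E -> measurable E -> measurable B ->
  P (E `&` S s @^-1` B) = (P E * P (S s @^-1` B))%E.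
Proof.
elim: s => [_ J E B _ _ mE mB|i s IH /= /andP[is_ us] J E B sJ fE mE mB].
  have -> : S [::] = cst 0 by apply/funext => w; rewrite /S big_nil.
  rewrite preimage_cst; case: ifP => _.
    by rewrite setIT probability_setT mule1.
  by rewrite setI0 measure0 mule0.
have iJ : i \in J by apply: sJ; rewrite inE eqxx.
have sub (K : {set I}) : {subset s <= K} -> {subset s <= (K :\ i)%SET}.
  move=> sK j js; rewrite !inE sK// andbT.
  by apply: contraNneq is_ => <-.
have sT : {subset s <= [set: I]%SET} by move=> j _; rewrite inE.
have sJ' : {subset s <= J} by move=> j js; apply: sJ; rewrite inE js orbT.
have rect A C : measurable A -> measurable C ->
    P (E `&` (X i @^-1` A `&` S s @^-1` C)) = (P E * P (X i @^-1` A `&` S s @^-1` C))%E.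
  move=> mA mC; have [PE fEA] := event_indep_cap fE iJ mA.
  have [_ fA] := event_indep_cap event_indep_setT (finset.in_setT i) mA.
  rewrite setTI in fA.
  rewrite setIA (IH us _ _ _ (sub _ sJ') fEA)//; last first.
    by apply: measurableI => //; exact: mXA.
  rewrite (IH us _ _ _ (sub _ sT) fA)//; last exact: mXA.
  by rewrite PE muleA.
have madd : measurable [set z : measurableTypeR R * measurableTypeR R | B (z.1 + z.2)].
  rewrite -[X in measurable X]setTI.
  apply: (measurable_funD (@measurable_fst _ _ (measurableTypeR R) (measurableTypeR R))
    (@measurable_snd _ _ (measurableTypeR R) (measurableTypeR R))) => //.
have -> : S (i :: s) = (fun w => X i w + S s w).
  by apply/funext => w; rewrite /S big_cons.
exact: (indep_event_pair mE (measurable_funPT (X i)) (mS s) rect madd).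
Qed.

(** [event_indep_sum] is used twice: for the first sum, to see that its events are
independent of the variables outside [s], and then for the second sum. *)
Lemma indep2_sums (s t : seq I) : uniq s -> uniq t -> {in s, forall i, i \notin t} ->
  indep2 P (fun w => \sum_(i <- s) X i w) (fun w => \sum_(i <- t) X i w).
Proof.
move=> us ut st A B mA mB.
apply: (@event_indep_sum t ut (~: [set i in s])%SET) => //.
- by move=> i it; rewrite !inE; apply: contraL it => /st.
- move=> K C Ks mC; rewrite setIC.
  have fC : event_indep (~: K)%SET (\bigcap_(i in [set` K]) X i @^-1` C i).
    exact: event_indep_bigcap.
  rewrite (@event_indep_sum s us (~: K)%SET)//; last exact: mcap.
    rewrite muleC; congr (_ * _)%E.
    by have := event_indep_setT (finset.subsetT K) mC; rewrite setTI probability_setT mul1e.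
  by move=> i is_; rewrite inE; apply/negP => /(fintype.subsetP Ks); rewrite !inE is_.
- exact: (measurable_preimage (mS s) mA).
Qed.

Lemma indep2_rest (n : nat) (f : 'I_n -> I) (i : 'I_n) : injective f ->
  indep2 P (fun w => \sum_(j < n | j != i) X (f j) w) (X (f i)).
Proof.
move=> f_inj.
have := @indep2_sums [seq f j | j <- index_enum 'I_n & j != i] [:: f i].
rewrite map_inj_uniq// filter_uniq ?index_enum_uniq// => /(_ isT isT) ind.
apply: (eq_indep2 _ _ (ind _)).
- by move=> w; rewrite big_map big_filter.
- by move=> w; rewrite big_seq1.
- move=> k /mapP[j]; rewrite mem_filter => /andP[ji _] ->.
  by rewrite inE (inj_eq f_inj).
Qed.

Lemma indep2_sums_ord (m n : nat) (f : 'I_m -> I) (g : 'I_n -> I) :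
  injective f -> injective g -> (forall i j, f i != g j) ->
  indep2 P (fun w => \sum_(i < m) X (f i) w) (fun w => \sum_(j < n) X (g j) w).
Proof.
move=> f_inj g_inj fg.
have := @indep2_sums [seq f i | i <- index_enum 'I_m] [seq g j | j <- index_enum 'I_n].
rewrite !map_inj_uniq// !index_enum_uniq// => /(_ isT isT) ind.
apply: (eq_indep2 _ _ (ind _)) => [w|w|k].
- by rewrite big_map.
- by rewrite big_map.
- move=> /mapP[i _ ->]; apply/mapP => -[j _ fgE].
  by have := fg i j; rewrite fgE eqxx.
Qed.

Lemma indep2_members (i j : I) : i != j -> indep2 P (X i) (X j).
Proof.
move=> ij; apply: (eq_indep2 _ _ (@indep2_sums [:: i] [:: j] isT isT _)).
- by move=> w; rewrite big_seq1.
- by move=> w; rewrite big_seq1.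
- by move=> k; rewrite !inE => /eqP ->.
Qed.

End independent_sums.

(** * The central limit theorem for Lipschitz test functions *)

Section integrals_on_probability_space.
Context d (T : measurableType d) (R : realType) (P : probability T R).
Local Notation itg f := (P.-integrable setT (EFin \o f)).

Lemma Rintegral_sum (I : Type) (s : seq I) (F : I -> T -> R) :
  (forall i, itg (F i)) ->
  itg (fun w => \sum_(i <- s) F i w) /\
  \int[P]_w (\sum_(i <- s) F i w) = \sum_(i <- s) \int[P]_w F i w.
Proof.
move=> iF.
have [||i1 ->] := @Rintegral_lin _ _ _ P [seq (1, F i) | i <- s]
    (fun w => \sum_(i <- s) F i w).
- by elim: s => //= i s IH; split.
- by move=> w; rewrite big_map; apply: eq_bigr => i _; rewrite mul1r.
by split => //; rewrite big_map; apply: eq_bigr => i _; rewrite mul1r.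
Qed.

Lemma itg_affine_dom (f X : T -> R) (b c : R) : measurable_fun setT f ->
  itg X -> (forall w, `|f w| <= b + c * `|X w|) -> itg f.
Proof.
move=> mf iX fX.
apply: (itg_dom measurableT mf (itgD measurableT (itg_cst P b) (itgZ measurableT c (itg_norm iX)))).
by move=> w _; exact: fX.
Qed.

Lemma Rintegral_norm_le_cst (f : T -> R) (b : R) : itg f ->
  (forall w, `|f w| <= b) -> `|\int[P]_w f w| <= b.
Proof.
move=> iF fb; apply: (le_trans (le_normr_Rintegral measurableT iF)).
rewrite -[leRHS](Rintegral_prob_cst P b); apply: le_Rintegral => //.
- exact: itg_norm.
- exact: itg_cst.
Qed.

End integrals_on_probability_space.

Section central_limit.
Context d (T : measurableType d) (R : realType) (P : probability T R).
Local Notation RR := (measurableTypeR R).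
Local Notation itg f := (P.-integrable setT (EFin \o f)).
Local Notation mu := (@lebesgue_measure R).
Local Notation phi := (normal_pdf (0 : R) 1).
Variables (n : nat) (X : 'I_n -> T -> R) (rho : R).
Hypothesis n_gt0 : (0 < n)%N.
Hypothesis sX : forall i, standardized P (X i).
Hypothesis X3 : forall i, \int[P]_w (`|X i w| ^+ 3) = rho.
Let rest i w := \sum_(j < n | j != i) X j w.
Hypothesis indX : forall i, indep2 P (rest i) (X i).

Let a : R := (Num.sqrt n%:R)^-1.
Let W w := a * \sum_(i < n) X i w.

Let a_ge0 : 0 <= a. Proof. by rewrite invr_ge0 sqrtr_ge0. Qed.

Let na2 : n%:R * a ^+ 2 = 1.
Proof. by rewrite exprVn sqr_sqrtr ?ler0n// mulfV// pnatr_eq0 -lt0n. Qed.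

Let mX i : measurable_fun setT (X i). Proof. by have [] := sX i. Qed.

Let iX i : itg (X i). Proof. exact: standardized_itg1. Qed.

Let mrest i : measurable_fun setT (rest i).
Proof.
rewrite /rest; under eq_fun do rewrite big_mkcond.
by apply: measurable_sum => j; case: (j != i).
Qed.

Let iW : itg W.
Proof. by apply: itgZ => //; have [] := @Rintegral_sum _ _ _ P _ (index_enum 'I_n) _ iX. Qed.

Let WE i w : W w = a * (rest i w + X i w).
Proof. by rewrite /W (bigD1 i)//= addrC. Qed.

(** The second moment of the normalized sum is 1 because each summand is orthogonal
to the sum of the others, and [2 |w| <= 1 + w^2]. *)
Lemma standardized_sum_norm_le1 : \int[P]_w `|W w| <= 1.
Proof.
have iXX i j : itg (fun w => X i w * X j w).
  have := itgD measurableT (standardized_itg2 (sX i)) (standardized_itg2 (sX j)).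
  move=> /(itg_dom measurableT); apply; first exact: measurable_funM.
  move=> w _; rewrite normrM; have := sqr_ge0 (`|X i w| - `|X j w|).
  have := @real_normK _ (X i w) (num_real _); have := @real_normK _ (X j w) (num_real _).
  have := mulr_ge0 (normr_ge0 (X i w)) (normr_ge0 (X j w)).
  lra.
have iXr i : itg (fun w => rest i w * X i w).
  have [|+ _] := @Rintegral_sum _ _ _ P _ (index_enum 'I_n)
    (fun j w => if j != i then X j w * X i w else 0).
    by move=> j; case: (j != i) => //; exact: itg_cst.
  apply: eq_integrable => // w _ /=; congr EFin.
  by rewrite /rest mulr_suml [RHS]big_mkcond.
have Xr0 i : \int[P]_w (rest i w * X i w) = 0.
  have mk : measurable_fun setT (fun z : RR * RR => (z.1 : R) * (z.2 : R)).
    apply: measurable_funM; first exact: (@measurable_fst _ _ RR RR).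
    exact: (@measurable_snd _ _ RR RR).
  have [|u|_ ->] := indep2_fubini (mrest i) (mX i) (indX i) mk.
  - exact: iXr.
  - exact: (itgZ measurableT u (iX i)).
  rewrite (_ : (fun w => _) = cst 0) ?Rintegral_prob_cst//.
  apply/funext => w /=; rewrite RintegralZl//.
  by have [_ _ -> _] := sX i; rewrite mulr0.
pose F i w := a ^+ 2 * (rest i w * X i w + X i w ^+ 2).
have iF i : itg (F i).
  by apply: itgZ => //; apply: itgD => //; exact: standardized_itg2.
have IF i : \int[P]_w F i w = a ^+ 2.
  rewrite RintegralZl//; last by apply: itgD => //; exact: standardized_itg2.
  rewrite RintegralD//; last exact: standardized_itg2.
  by have [_ _ _ ->] := sX i; rewrite Xr0 add0r mulr1.
have [iS SE] := @Rintegral_sum _ _ _ P _ (index_enum 'I_n) F iF.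
have WS w : W w ^+ 2 = \sum_(i < n) F i w.
  rewrite expr2 {1}/W mulr_sumr mulr_suml; apply: eq_bigr => i _.
  by rewrite (WE i) /F; ring.
have I2 : \int[P]_w (W w ^+ 2) = 1.
  under eq_Rintegral do rewrite WS.
  rewrite SE (eq_bigr (fun=> a ^+ 2)) => [|i _]; last exact: IF.
  by rewrite sumr_const card_ord -mulr_natl.
have iW2 : itg (fun w => W w ^+ 2).
  by apply: eq_integrable iS => // w _ /=; rewrite WS.
apply: (@le_trans _ _ (\int[P]_w (2^-1 + 2^-1 * W w ^+ 2))).
  apply: le_Rintegral => //.
  - exact: itg_norm.
  - by apply: itgD => //; [exact: itg_cst|exact: itgZ].
  - move=> w _; have := sqr_ge0 (`|W w| - 1); have := @real_normK _ (W w) (num_real _).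
    lra.
rewrite RintegralD//; [|exact: itg_cst|exact: itgZ].
by rewrite RintegralZl// I2 Rintegral_prob_cst; lra.
Qed.

(** Leave one out. By the Stein equation, [h (W w) - E h(Z)] is minus the sum over
[i] of [X i * G (X i) - g (X i)], where [G x = a * f (a * (rest + x))] and [g] is
its derivative; the normalization [n a^2 = 1] distributes [f' (W w)] evenly among
the summands. For a frozen value of [rest], which is independent of [X i], the
derivative [g] is [2 K a^3]-Lipschitz, so [stein_identity_defect] bounds each
term by [13/8 K a^3 rho]. *)
Lemma wasserstein_clt (h : R -> R) (K : R) :
  (forall x y, `|h x - h y| <= K * `|x - y|) ->
  `| \int[P]_w h (W w) - \int[mu]_t (h t * phi t) | <= 13 / 8 * K * a * rho.
Proof.
move=> hK; have [f [f' [df f'E fK f'K]]] := stein_solution hK.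
set c := \int[mu]_t (h t * phi t).
have K0 : 0 <= K := le_trans (normr_ge0 _) (fK 0).
have mh := lipschitz_measurable hK.
have mf' := lipschitz_measurable f'K.
have mf := continuous_measurable_fun (is_derive1_continuous df).
have mW := itg_measurable iW.
have ih : itg (fun w => h (W w)).
  apply: (itg_affine_dom (b := `|h 0|) (c := K) _ iW); first exact: measurableT_comp.
  by move=> w; exact: lipschitz_affine_bound.
have f'b := lipschitz_affine_bound f'K.
pose k (z : RR * RR) : R := (z.2 : R) * (a * f (a * ((z.1 : R) + (z.2 : R)))) -
   a ^+ 2 * f' (a * ((z.1 : R) + (z.2 : R))).
have mk : measurable_fun setT k.
  have m12 : measurable_fun setT (fun z : RR * RR => a * ((z.1 : R) + (z.2 : R))).
    apply: measurable_funM => //; apply: measurable_funD.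
      exact: (@measurable_fst _ _ RR RR).
    exact: (@measurable_snd _ _ RR RR).
  have m2 : measurable_fun setT (fun z : RR * RR => (z.2 : R)).
    exact: (@measurable_snd _ _ RR RR).
  apply: measurable_funB.
    apply: (measurable_funM m2); apply: measurable_funM => //.
    exact: (measurableT_comp mf m12).
  apply: measurable_funM => //; exact: (measurableT_comp mf' m12).
have iXf i (U : T -> R) : measurable_fun setT U -> itg (fun w => X i w * (a * f (U w))).
  move=> mU; apply: (itg_affine_dom (b := 0) (c := a * K) _ (iX i)).
    apply: measurable_funM => //; apply: measurable_funM => //; exact: measurableT_comp.
  move=> w; rewrite add0r !normrM (ger0_norm a_ge0) mulrC ler_wpM2r//.
  by rewrite ler_wpM2l.
have mrX i : measurable_fun setT (fun w => a * (rest i w + X i w)).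
  by apply: measurable_funM => //; exact: measurable_funD.
have muX i u : measurable_fun setT (fun w => a * (u + X i w)).
  by apply: measurable_funM => //; exact: measurable_funD.
have ik i : itg (fun w => k (rest i w, X i w)).
  apply: itgB => //; first exact: (iXf i _ (mrX i)).
  apply: itgZ => //; apply: (itg_affine_dom (b := `|f' 0|) (c := 2 * K) _ iW).
    exact: (measurableT_comp mf' (mrX i)).
  by move=> w; rewrite /= -WE.
have ifu i u : itg (fun w => a ^+ 2 * f' (a * (u + X i w))).
  have iuX : itg (fun w => a * (u + X i w)).
    by apply: itgZ => //; apply: itgD => //; exact: itg_cst.
  apply: itgZ => //; apply: (itg_affine_dom (b := `|f' 0|) (c := 2 * K) _ iuX) => //.
  exact: (measurableT_comp mf' (muX i u)).
have iku i u : itg (fun w => k (u, X i w)).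
  by apply: itgB; [|exact: (iXf i _ (muX i u))|exact: ifu].
have kE i : `|\int[P]_w k (rest i w, X i w)| <= 13 / 8 * K * a ^+ 3 * rho.
  have [iI ->] := indep2_fubini (mrest i) (mX i) (indX i) mk (ik i) (iku i).
  apply: Rintegral_norm_le_cst => // w.
  set u := rest i w.
  have dG x : is_derive x (1 : R) (fun x => a * f (a * (u + x))) (a ^+ 2 * f' (a * (u + x))).
    have d1 : is_derive x 1 (fun x : R => a * (u + x)) a.
      by apply: is_derive_eq; rewrite /GRing.scale/=; ring.
    have d2 := @is_derive1_comp R f (fun x => a * (u + x)) x _ _ (df (a * (u + x))) d1.
    apply: (is_derive_eq (is_deriveZ a d2)).
    by rewrite /GRing.scale/=; ring.
  have gM x y : `|a ^+ 2 * f' (a * (u + x)) - a ^+ 2 * f' (a * (u + y))| <=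
      (2 * K * a ^+ 3) * `|x - y|.
    rewrite -mulrBr normrM ger0_norm ?sqr_ge0//.
    have := ler_wpM2l (sqr_ge0 a) (f'K (a * (u + x)) (a * (u + y))).
    rewrite (_ : a * (u + x) - a * (u + y) = a * (x - y)); last by ring.
    rewrite normrM (ger0_norm a_ge0); lra.
  have M0 : 0 <= 2 * K * a ^+ 3 by rewrite !mulr_ge0// exprn_ge0.
  have GB x : `|a * f (a * (u + x))| <= a * K by rewrite normrM (ger0_norm a_ge0) ler_wpM2l.
  have := stein_identity_defect (sX i) dG gM M0 GB.
  rewrite X3 /k/= -RintegralB//; first by rewrite /u; lra.
  exact: (iXf i _ (muX i u)).
have [_ SE] := @Rintegral_sum _ _ _ P _ (index_enum 'I_n) (fun i w => k (rest i w, X i w)) ik.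
have hS w : h (W w) - c = - \sum_(i < n) k (rest i w, X i w).
  rewrite (_ : h (W w) - c = f' (W w) - W w * f (W w)); last by rewrite f'E -/c; ring.
  rewrite /k/=; under eq_bigr do rewrite -WE.
  rewrite sumrB sumr_const card_ord -[(_ *+ n)%R]mulr_natl mulrA na2 mul1r.
  by rewrite -mulr_suml; move: (f' _) (f _) => y z; rewrite /W; ring.
have -> : \int[P]_w h (W w) - c = - \sum_(i < n) \int[P]_w k (rest i w, X i w).
  rewrite -{1}(Rintegral_prob_cst P c) -RintegralB//; last exact: itg_cst.
  under eq_Rintegral do rewrite hS.
  rewrite RintegralN// ?SE//.
  by have [] := @Rintegral_sum _ _ _ P _ (index_enum 'I_n) (fun i w => k (rest i w, X i w)) ik.
rewrite normrN (le_trans (ler_norm_sum _ _ _))//.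
apply: (@le_trans _ _ (\sum_(i < n) 13 / 8 * K * a ^+ 3 * rho)).
  by apply: ler_sum => i _; exact: kE.
rewrite sumr_const card_ord -[leLHS]mulr_natl.
rewrite (_ : n%:R * _ = (n%:R * a ^+ 2) * (13 / 8 * K * a * rho)); last by ring.
by rewrite na2 mul1r.
Qed.

End central_limit.

(** * The product normal limit *)

(** The density is the Radon-Nikodym derivative up to a negligible set. *)
Lemma Rintegral_normal_prob (R : realType) (g : R -> R) :
  measurable_fun setT g ->
  (normal_prob (0 : R) 1).-integrable setT (EFin \o g) ->
  \int[normal_prob (0 : R) 1]_x g x =
  \int[@lebesgue_measure R]_x (g x * normal_pdf 0 1 x).
Proof.
move=> mg ig; congr fine.
have dom := @normal_prob_dominates R 0 1.
rewrite -(Radon_Nikodym_change_of_variables dom)//=.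
have mEg : measurable_fun setT (fun x => (g x)%:E) by exact/measurable_EFinP.
under [RHS]eq_integral do rewrite EFinM.
apply: ae_eq_integral => //.
- by apply: emeasurable_funM => //; apply: (measurable_int (@lebesgue_measure R)).
- by apply: emeasurable_funM => //; apply/measurable_EFinP; exact: measurable_phi.
- apply: ae_eqe_mul2l => /=.
  rewrite Radon_NikodymE//=.
  case: cid => /= k [k1 k2 k3].
  apply: integral_ae_eq => //=.
  + by apply/measurable_EFinP; exact: measurable_phi.
  + by move=> E _ mE; rewrite -k3.
Qed.

Section transfer.
Context d (T : measurableType d) (R : realType) (P : probability T R).
Local Notation itg f := (P.-integrable setT (EFin \o f)).

Lemma eq_distr_integral (X Y : {RV P >-> R}) (f : R -> R) :
  eq_distr X Y -> measurable_fun setT f -> itg (fun w => f (Y w)) ->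
  itg (fun w => f (X w)) /\ \int[P]_w f (X w) = \int[P]_w f (Y w).
Proof.
move=> XY mf iY.
have mEf : measurable_fun setT (EFin \o f) by exact/measurable_EFinP.
have iX : itg (fun w => f (X w)).
  apply/integrableP; split.
    apply/measurable_EFinP; exact: (measurableT_comp mf (measurable_funPT X)).
  have /integrableP[_] := iY.
  rewrite -(@ge0_integral_distribution _ _ _ _ _ P Y (fun x => `|(f x)%:E|%E))//; last first.
    exact: measurableT_comp.
  rewrite -(@ge0_integral_distribution _ _ _ _ _ P X (fun x => `|(f x)%:E|%E))//; last first.
    exact: measurableT_comp.
  by rewrite (eq_measure_integral (distribution P X))// => A mA _; exact/esym/XY.
split => //; congr fine.
have := @integral_distribution _ _ _ _ _ P X _ mEf iX => /= <-.
have := @integral_distribution _ _ _ _ _ P Y _ mEf iY => /= <-.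
by apply: eq_measure_integral => A mA _; rewrite [LHS]XY.
Qed.

Lemma standardizedP (X : {RV P >-> R}) : ('E_P[X] = 0)%E -> ('V_P[X] = 1)%E ->
  ('E_P[fun w => (`|X w| ^+ 3)%R] < +oo)%E -> standardized P X.
Proof.
move=> EX VX X3; split.
- exact: measurable_funPT.
- apply/integrableP; split.
    apply/measurable_EFinP; apply: measurable_funX.
    by apply: measurableT_comp => //; exact: measurable_funPT.
  move: X3; rewrite unlock; apply: le_lt_trans.
  rewrite le_eqVlt; apply/orP; left; apply/eqP.
  by apply: eq_integral => w _ /=; rewrite ger0_norm ?exprn_ge0.
- by move: EX; rewrite /Rintegral unlock => ->.
- move: VX; rewrite /variance unlock EX/= unlock /Rintegral => VX.
  suff -> : (\int[P]_w (X w ^+ 2)%:E = 1)%E by [].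
  rewrite -VX; apply: eq_integral => w _ /=.
  by rewrite -[RHS]/(((X w - 0) * (X w - 0))%:E) subr0 expr2.
Qed.

Lemma standardized_eq_distr (X Y : {RV P >-> R}) : eq_distr X Y ->
  standardized P Y ->
  standardized P X /\ \int[P]_w (`|X w| ^+ 3) = \int[P]_w (`|Y w| ^+ 3).
Proof.
move=> XY sY; have [_ iY3 Y1 Y2] := sY.
have m3 : measurable_fun setT (fun x : R => `|x| ^+ 3).
  by apply: measurable_funX; exact: normr_measurable.
have [i3 E3] := eq_distr_integral XY m3 iY3.
have [_ E1] := eq_distr_integral XY (@measurable_id _ _ setT) (standardized_itg1 sY).
have m2 : measurable_fun setT (fun x : R => x ^+ 2) by exact: exprn_measurable.
have [_ E2] := eq_distr_integral XY m2 (standardized_itg2 sY).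
split => //; split => //.
  by rewrite -Y1.
by rewrite E2.
Qed.

End transfer.

Section supnorm.
Variable R : realType.

Lemma supnorm_ge (g : R -> R) x : bounded_fun g -> `|g x| <= supnorm g.
Proof.
move=> [M [_ hM]]; apply: ub_le_sup; last by exists x.
exists (M + 1) => _ [y _ <-].
by apply: hM => //; rewrite ltrDl.
Qed.

(** A set without a supremum has [sup] equal to 0. *)
Lemma supnorm_ge0 (g : R -> R) : 0 <= supnorm g.
Proof.
rewrite /supnorm.
have [hs|/sup_out->//] := pselect (has_sup (range (fun x => `|g x|))).
apply: (le_trans (normr_ge0 (g 0))); apply: ub_le_sup; first exact: hs.2.
by exists 0.
Qed.

Lemma C1b_lipschitz (h : R -> R) : C1b h ->
  forall x y, `|h x - h y| <= supnorm h^`()%classic * `|x - y|.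
Proof.
move=> [dh _ bh']; apply: (@derive_bounded_lipschitz _ _ h^`()%classic).
  by move=> x; rewrite derive1E; exact: derivableP.
by move=> x; exact: supnorm_ge.
Qed.

End supnorm.

Section gaussian_smoothing.
Variables (R : realType) (h : R -> R) (K B : R).
Hypothesis hK : forall x y, `|h x - h y| <= K * `|x - y|.
Hypothesis hB : forall x, `|h x| <= B.
Local Notation mu := (@lebesgue_measure R).
Local Notation gamma := (normal_prob (0 : R) 1).
Local Notation phi := (normal_pdf (0 : R) 1).

(** The mean of [h] under the centred normal law of standard deviation [|y|]. *)
Definition gaussian_scale_mixture y := \int[mu]_z (h (z * y) * phi z).
Local Notation H := gaussian_scale_mixture.

Let K0 : 0 <= K.
Proof.
have := hK 1 0; rewrite subr0 normr1 mulr1; exact: le_trans.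
Qed.

Lemma scaled_lipschitz y x x' : `|h (x * y) - h (x' * y)| <= K * `|y| * `|x - x'|.
Proof. by rewrite (le_trans (hK _ _))// -mulrBl normrM mulrCA mulrC mulrAC. Qed.

Let mh : measurable_fun setT h.
Proof. exact: lipschitz_measurable hK. Qed.

Let iH y : mu.-integrable setT (EFin \o (fun z => h (z * y) * phi z)).
Proof. exact: (itg_lipschitz_phi (scaled_lipschitz y)). Qed.

(** No constant is lost because [E|Z| <= 1]. *)
Lemma gaussian_scale_mixture_lipschitz y y' : `|H y - H y'| <= K * `|y - y'|.
Proof.
rewrite /H -RintegralB//.
have iB := itgB measurableT (iH y) (iH y').
apply: (le_trans (le_normr_Rintegral measurableT iB)).
apply: (@le_trans _ _ (\int[mu]_z (K * `|y - y'| * (`|z| * phi z)))).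
  apply: le_Rintegral => //.
  - exact: itg_norm.
  - by apply: itgZ => //; exact: itg_normtphi.
  - move=> z _; rewrite -mulrBl normrM (gtr0_norm (phi_gt0 z)) mulrA.
    rewrite ler_wpM2r ?normal_pdf_ge0// (le_trans (hK _ _))//.
    by rewrite -mulrBr normrM mulrA mulrAC.
rewrite RintegralZl//; last exact: itg_normtphi.
by rewrite ler_piMr ?Rintegral_normtphi_le1// mulr_ge0.
Qed.

Let itg_bounded (g : R -> R) : measurable_fun setT g -> (forall x, `|g x| <= B) ->
  gamma.-integrable setT (EFin \o g).
Proof.
move=> mg gB; apply: (@itg_dom _ (measurableTypeR R) R gamma setT measurableT g (fun=> B)).
- exact: mg.
- exact: itg_cst.
- by move=> x _; exact: gB.
Qed.

Let msc (y : R) : measurable_fun setT (fun z : R => h (z * y)).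
Proof. by apply: (measurableT_comp mh); exact: measurable_funM. Qed.

Lemma gaussian_scale_mixtureE y : H y = \int[gamma]_z h (z * y).
Proof. by rewrite Rintegral_normal_prob//; exact: itg_bounded. Qed.

Lemma PN21_gaussian_scale_mixture : PN21 h = \int[mu]_z (H z * phi z).
Proof.
have mH := lipschitz_measurable gaussian_scale_mixture_lipschitz.
have HB x : `|H x| <= B.
  rewrite gaussian_scale_mixtureE; apply: Rintegral_norm_le_cst => //.
  exact: itg_bounded.
rewrite -Rintegral_normal_prob//; last exact: itg_bounded.
rewrite /PN21 unlock; congr fine.
pose RR := measurableTypeR R.
have mk : measurable_fun setT (fun z : RR * RR => h ((z.1 : R) * (z.2 : R))).
  apply: (measurableT_comp mh); apply: measurable_funM.
    exact: (@measurable_fst _ _ RR RR).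
  exact: (@measurable_snd _ _ RR RR).
have ik : (gamma \x gamma)%E.-integrable setT (fun z : RR * RR => (h ((z.1 : R) * (z.2 : R)))%:E).
  apply: (@itg_dom _ _ R (gamma \x gamma)%E setT measurableT _ (fun=> B)).
  - exact: mk.
  - exact: itg_cst.
  - by move=> x _; exact: hB.
rewrite -[LHS](integral12_prod_meas1 ik) /fubini_F/=.
apply: eq_integral => x _.
rewrite gaussian_scale_mixtureE /Rintegral.
under [in RHS]eq_integral do rewrite mulrC.
rewrite fineK//; apply: integrable_fin_num => //.
by apply: itg_bounded => //; apply: (measurableT_comp mh); exact: measurable_funM.
Qed.

End gaussian_smoothing.

Theorem corollary4p2 (R : realType) (d : measure_display)
    (T : measurableType d) (P : probability T R) (m n : nat)
    (X : {RV P >-> R}) (Xs : 'I_m -> {RV P >-> R})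
    (Y : {RV P >-> R}) (Ys : 'I_n -> {RV P >-> R})
    (h : R -> R)
    (m_gt0 : (0 < m)%N) (n_gt0 : (0 < n)%N)
    (indep : mutually_independent (two_samples X Xs Y Ys))
    (EX : ('E_P[X] = 0)%E) (EY : ('E_P[Y] = 0)%E)
    (VX : ('V_P[X] = 1)%E) (VY : ('V_P[Y] = 1)%E)
    (X3 : ('E_P[fun w => (`|X w| ^+ 3)%R] < +oo)%E)
    (Y3 : ('E_P[fun w => (`|Y w| ^+ 3)%R] < +oo)%E)
    (XsX : forall i, eq_distr (Xs i) X)
    (YsY : forall j, eq_distr (Ys j) Y)
    (hh : C1b h) :
  let W1 := fun w => \sum_(i < m) Xs i w in
  let W2 := fun w => \sum_(j < n) Ys j w in
  let W := fun w => (Num.sqrt (m * n)%:R)^-1 * (W1 w * W2 w) in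
  `| fine 'E_P[fun w => h (W w)] - PN21 h | <=
    13 / 8 * ((Num.sqrt m%:R)^-1 + (Num.sqrt n%:R)^-1) *
    (supnorm h^`()%classic + 9 / 2 * supnorm (fun x => h x - PN21 h)) *
    fine 'E_P[fun w => `|X w| ^+ 3 * `|Y w| ^+ 3].
Proof.
set rX := \int[P]_w (`|X w| ^+ 3); set rY := \int[P]_w (`|Y w| ^+ 3).
pose W1 w := \sum_(i < m) Xs i w; pose W2 w := \sum_(j < n) Ys j w.
pose W w := (Num.sqrt (m * n)%:R)^-1 * (W1 w * W2 w).
cbv zeta.
have sX : standardized P X := standardizedP EX VX X3.
have sY : standardized P Y := standardizedP EY VY Y3.
have sXs i : standardized P (Xs i) by have [] := standardized_eq_distr (XsX i) sX.
have sYs j : standardized P (Ys j) by have [] := standardized_eq_distr (YsY j) sY.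
have X3s i : \int[P]_w (`|Xs i w| ^+ 3) = rX.
  by have [] := standardized_eq_distr (XsX i) sX.
have Y3s j : \int[P]_w (`|Ys j w| ^+ 3) = rY.
  by have [] := standardized_eq_distr (YsY j) sY.
pose fX (i : 'I_m) : option 'I_m + option 'I_n := inl (Some i).
pose fY (j : 'I_n) : option 'I_m + option 'I_n := inr (Some j).
have fX_inj : injective fX by move=> i j [].
have fY_inj : injective fY by move=> i j [].
have indXs i : indep2 P (fun w => \sum_(j < m | j != i) Xs j w) (Xs i).
  exact: (indep2_rest indep i fX_inj).
have indYs i : indep2 P (fun w => \sum_(j < n | j != i) Ys j w) (Ys i).
  exact: (indep2_rest indep i fY_inj).
have indW : indep2 P W2 W1 by exact: (indep2_sums_ord indep fY_inj fX_inj).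
have indXY : indep2 P X Y by exact: (@indep2_members _ _ _ P _ _ indep (inl None) (inr None)).
have hK := C1b_lipschitz hh.
set K := supnorm h^`()%classic in hK *.
have mh := lipschitz_measurable hK.
have K0 : 0 <= K := supnorm_ge0 _.
have [B hB] : exists B, forall x, `|h x| <= B.
  have [_ bh _] := hh; exists (supnorm h) => x; exact: supnorm_ge.
set a := (Num.sqrt m%:R)^-1; set b := (Num.sqrt n%:R)^-1.
have a0 : 0 <= a by rewrite invr_ge0 sqrtr_ge0.
have b0 : 0 <= b by rewrite invr_ge0 sqrtr_ge0.
pose U w := a * W1 w; pose V w := b * W2 w.
have WE w : W w = U w * V w.
  by rewrite /W /U /V natrM sqrtrM ?ler0n// invfM mulrACA.
have rX1 : 1 <= rX := standardized_third_ge1 sX.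
have rY1 : 1 <= rY := standardized_third_ge1 sY.
have -> : fine 'E_P[fun w => `|X w| ^+ 3 * `|Y w| ^+ 3] = rX * rY.
  have m3 : measurable_fun setT (fun x : R => `|x| ^+ 3).
    by apply: measurable_funX; exact: normr_measurable.
  have [mX iX3 _ _] := sX; have [mY iY3 _ _] := sY.
  rewrite unlock; apply: (indep2_expectation_mul _ _ (indep2_comp m3 m3 indXY)) => //.
  - exact: measurableT_comp.
  - exact: measurableT_comp.
  - by move=> w; rewrite exprn_ge0.
  - by move=> w; rewrite exprn_ge0.
have -> : fine 'E_P[fun w => h (W w)] = \int[P]_w h (U w * V w).
  rewrite unlock; congr fine; apply: eq_integral => w _.
  by rewrite WE.
pose H := gaussian_scale_mixture h.
have HK : forall y y', `|H y - H y'| <= K * `|y - y'|.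
  exact: gaussian_scale_mixture_lipschitz hK.
have mU : measurable_fun setT U.
  apply: measurable_funM => //; apply: measurable_sum => i; exact: measurable_funPT.
have mV : measurable_fun setT V.
  apply: measurable_funM => //; apply: measurable_sum => i; exact: measurable_funPT.
have mH := lipschitz_measurable HK.
(* [V] is replaced by a standard normal variable in [H V]. *)
have step2 : `|\int[P]_w H (V w) - PN21 h| <= 13 / 8 * K * b * rY.
  rewrite (PN21_gaussian_scale_mixture hK hB).
  exact: (wasserstein_clt n_gt0 sYs Y3s indYs HK).
(* [U] is replaced by a standard normal variable, for a frozen value [v] of [V]. *)
have step1v v : `|\int[P]_w h (U w * v) - H v| <= 13 / 8 * (K * `|v|) * a * rX.
  exact: (wasserstein_clt m_gt0 sXs X3s indXs (scaled_lipschitz hK v)).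
have ihb (F : T -> R) : measurable_fun setT F ->
    P.-integrable setT (EFin \o (fun w => h (F w))).
  move=> mF; apply: (itg_dom measurableT _ (itg_cst P B)).
    exact: measurableT_comp.
  by move=> w _; exact: hB.
have iV : P.-integrable setT (EFin \o V).
  apply: itgZ => //; have [|+ _] := @Rintegral_sum _ _ _ P _
    (index_enum 'I_n) (fun j => Ys j : T -> R).
    by move=> j; exact: standardized_itg1.
  by [].
have mk : measurable_fun setT
    (fun z : measurableTypeR R * measurableTypeR R => h ((z.2 : R) * (z.1 : R))).
  apply: (measurableT_comp mh); apply: measurable_funM.
    exact: (@measurable_snd _ _ (measurableTypeR R) (measurableTypeR R)).
  exact: (@measurable_fst _ _ (measurableTypeR R) (measurableTypeR R)).
have indVU : indep2 P V U.
  apply: (@indep2_comp _ _ _ P W2 W1 (fun x => b * x) (fun x => a * x)) => //;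
    exact: measurable_funM.
have muv v : measurable_fun setT (fun w => U w * v) by exact: measurable_funM.
have [iI IE] := indep2_fubini mV mU indVU mk
  (ihb _ (measurable_funM mU mV)) (fun v => ihb _ (muv v)).
have iH : P.-integrable setT (EFin \o (fun w => H (V w))).
  apply: (itg_affine_dom (b := `|H 0|) (c := K) _ iV); first exact: measurableT_comp.
  by move=> w; exact: lipschitz_affine_bound.
have step1 : `|\int[P]_w h (U w * V w) - \int[P]_w H (V w)| <= 13 / 8 * K * a * rX.
  rewrite IE -RintegralB//=.
  apply: (le_trans (le_normr_Rintegral measurableT (itgB measurableT iI iH))).
  apply: (@le_trans _ _ (\int[P]_w (13 / 8 * K * a * rX * `|V w|))).
    apply: le_Rintegral => //.
    - exact: itg_norm (itgB measurableT iI iH).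
    - by apply: itgZ => //; exact: itg_norm.
    - by move=> w _; have := step1v (V w); rewrite /=; lra.
  rewrite RintegralZl//; last exact: itg_norm.
  have c0 : 0 <= 13 / 8 * K * a * rX by rewrite !mulr_ge0// (le_trans ler01).
  rewrite -[leRHS]mulr1; apply: (ler_wpM2l c0).
  exact: (standardized_sum_norm_le1 n_gt0 sYs indYs).
have S0 : 0 <= supnorm (fun x => h x - PN21 h) := supnorm_ge0 _.
set S := supnorm _ in S0 *.
have tri := ler_normD (\int[P]_w h (U w * V w) - \int[P]_w H (V w))
  (\int[P]_w H (V w) - PN21 h).
rewrite addrA subrK in tri.
apply: (le_trans tri); apply: (le_trans (lerD step1 step2)).
have rX0 : 0 <= rX := le_trans ler01 rX1.
have rY0 : 0 <= rY := le_trans ler01 rY1.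
apply: (@le_trans _ _ (13 / 8 * (a + b) * K * (rX * rY))).
  have := ler_wpM2l (mulr_ge0 (mulr_ge0 K0 a0) rX0) rY1.
  have := ler_wpM2l (mulr_ge0 (mulr_ge0 K0 b0) rY0) rX1.
  lra.
rewrite ler_wpM2r ?mulr_ge0// ler_wpM2l ?mulr_ge0 ?addr_ge0//.
by rewrite lerDl mulr_ge0.
Qed.
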